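(* Fix $n\in\{0,\dots,N-1\}$. Assume that there are constants $\lambda_1,\lambda_2>0$ such that for all $x,y\in\mathbb{R}^d$ and every grid time $t\in\{t_0,\dots,t_{N-1}\}$ $$|\rho(x,t;y,t+\Delta t)|\le \frac{1}{\lambda_1}\exp(-\lambda_1\|x-y\|^2),\qquad |\nabla_x\rho(x,t;y,t+\Delta t)|\le \frac{1}{\lambda_2}\exp(-\lambda_2\|x-y\|^2),$$ and that $|\widehat V_i(t_{n+1},x)|\le L(\|x\|+1)$ for all $x\in\mathbb{R}^d$, all $i=1,\dots,D$ and some $L>0$. Then for any fixed point $x\in\mathbb{R}^d$ there exist positive constants $C_0$ (used as the truncation constant in the definition of $\widehat g_j(t_n,\cdot)$), $C_2$ and $\sigma$, depending only on $d,L,\|x\|,\lambda_1,\lambda_2$, such that for any $\delta>0$ and every $i\in\{1,\dots,D\}$ $$\mathbb{P}\big(|\widehat V_i(t_n,x)-\widetilde V_i(t_n,x)|\ge\delta\big)\le 2D\exp\Big(-\frac{k m_Y\delta^2}{18\sigma^2}\Big)+2D\cdot B(\delta),$$ where $$B(\delta)=\begin{cases} \exp\left(-\dfrac{M\left(\frac{M-k}{M}-p^c_{\delta/(4C_2)}\right)_+^2}{2}\right) & \text{if }\delta/C_2\le 1,\\[3mm] \exp\left(-\dfrac{M\left(\frac{M-k}{M}-p^c_{\sqrt{\delta/(4C_2)}}\right)_+^2}{2}\right) & \text{if }\delta/C_2>1,\end{cases}$$ and $p^c_r=\mathbb{P}(X_{t_n}\notin B(x,r))$, with $B(x,r)$ the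 Euclidean ball of radius $r$ centered at $x$.
   Context: Setting. Let $d,D,M,N,m_Y,k$ be positive integers with $k\le M$, $T>0$, $\Delta t=T/N$, $t_n=n\Delta t$. $(X_{t_n})_{n=0}^N$ is a (time-discretized) Markov process in $\mathbb{R}^d$ whose starting point is drawn from a sub-Gaussian distribution $\mu_0$ and whose one-step transition kernel from $t_n$ to $t_{n+1}$ has a density $y\mapsto\rho(x,t_n;y,t_n+\Delta t)$. There are $D$ modes with payoff functions $f_j(t,x)$ and switching costs $c_{ij}(t,x)$ satisfying $c_{ii}=0$, $c_{ij}>0$ for $i\ne j$, and $c_{ij}+c_{jl}\ge c_{il}$ for pairwise distinct $i,j,l$. $\|\cdot\|$ is the Euclidean norm and $(a)_+=\max\{a,0\}$. Data. $\mathcal{X}=\{X^s_{t_0},\dots,X^s_{t_N};\ s=1,\dots,M\}$ consists of $M$ independent copies of the trajectory. For each $n<N$ and $s$, $\widetilde X^{s,\hat s}_{t_{n+1}}$, $\hat s=1,\dots,m_Y$, are simulated one-step transitions started from $X^s_{t_n}$: conditional on $\mathcal{X}$, all of these are mutually independent across $(n,s,\hat s)$, and $\widetilde X^{s,\hat s}_{t_{n+1}}$ has density $\rho(X^s_{t_n},t_n;\cdot,t_{n+1})$. $\mathcal{N}_{t_n}(x)$ is the set of indices $s$ of the $k$ points among $X^1_{t_n},\dots,X^M_{t_n}$ nearest to $x$. Estimators (backward recursion). Start from $\widehat V_j(t_N,x)=0$. For $n=N-1,\dots,0$, given $\widehat V_j(t_{n+1},\cdot)$, $j=1,\dots,D$,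 define $$g_j(t_n,x)=\int_{\mathbb{R}^d}\widehat V_j(t_{n+1},y)\rho(x,t_n;y,t_n+\Delta t)\,dy,\qquad \widetilde g_j(t_n,x)=\frac{1}{k m_Y}\sum_{s\in\mathcal{N}_{t_n}(x)}\sum_{\hat s=1}^{m_Y}\widehat V_j(t_{n+1},\widetilde X^{s,\hat s}_{t_{n+1}}),$$ the truncation $$\widehat g_j(t_n,x)=\mathrm{sign}(\widetilde g_j(t_n,x))\min\{|\widetilde g_j(t_n,x)|,\,2C_0(\|x\|+1)\}$$ with a given constant $C_0$ (which may depend on $n$), and $$\widetilde V_i(t_n,x)=\max_{j=1,\dots,D}[\Delta t f_j(t_n,x)-c_{ij}(t_n,x)+g_j(t_n,x)],\qquad \widehat V_i(t_n,x)=\max_{j=1,\dots,D}[\Delta t f_j(t_n,x)-c_{ij}(t_n,x)+\widehat g_j(t_n,x)].$$ Note that $g_j$ and $\widetilde V_i$ are random, through $\widehat V_j(t_{n+1},\cdot)$. *)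

(* Defs.v *)
From HB Require Import structures.
From mathcomp Require Import all_boot all_order all_algebra.
From mathcomp Require Import all_classical all_reals all_analysis.

Set Implicit Arguments.
Unset Strict Implicit.
Unset Printing Implicit Defensive.

Import Order.TTheory GRing.Theory Num.Theory.
Import numFieldNormedType.Exports.

Local Open Scope classical_set_scope.
Local Open Scope ring_scope.

Definition sigma_gen (I Omega : Type) (d : measure_display)
    (E : measurableType d) (J : set I) (X : I -> Omega -> E) :
    set (set Omega) :=
  <<s \bigcup_(i in J) preimage_set_system setT (X i) measurable >>.

Definition mx_display : measure_display.
Proof. exact: default_measure_display. Qed.

Section measurable_matrix.
Context {R : realType} (m n : nat).

Let entries : 'I_m * 'I_n -> 'M[R]_(m, n) -> R := fun ij A => A ij.1 ij.2.

Let mx_set0 : sigma_gen setT entries set0.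
Proof. exact: sigma_algebra0. Qed.

Let mx_setC A : sigma_gen setT entries A -> sigma_gen setT entries (~` A).
Proof. exact: sigma_algebraC. Qed.

Let mx_bigcup (F : (set 'M[R]_(m, n))^nat) :
  (forall i, sigma_gen setT entries (F i)) ->
  sigma_gen setT entries (\bigcup_i (F i)).
Proof. exact: sigma_algebra_bigcup. Qed.

(* The sigma-algebra generated by the entries, that is, the Borel one. *)
HB.instance Definition _ := @isMeasurable.Build mx_display
  'M[R]_(m, n) (sigma_gen setT entries) mx_set0 mx_setC mx_bigcup.

Lemma measurable_entry (i : 'I_m) (j : 'I_n) :
  measurable_fun setT (fun A : 'M[R]_(m, n) => A i j).
Proof.
move=> _ Y mY; apply: sub_sigma_algebra.
by exists (i, j) => //; exists Y.
Qed.

Lemma measurable_fun_mxP d (T : measurableType d) (f : T -> 'M[R]_(m, n)) :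
  measurable_fun setT f <->
  forall i j, measurable_fun setT (fun x => f x i j).
Proof.
split=> [mf i j|mf].
  exact: (measurableT_comp (measurable_entry i j) mf).
apply: (@measurability _ _ _ _ setT f
  (\bigcup_(ij in setT) preimage_set_system setT (entries ij) measurable)) => //.
move=> _ [_ [[i j] _ [B mB <-]] <-].
rewrite !setTI -comp_preimage -[X in measurable X]setTI.
exact: mf.
Qed.

End measurable_matrix.

Section lebesgue_rV.
Context {R : realType}.

Definition rV_cons n (p : R * 'rV[R]_n) : 'rV[R]_n.+1 :=
  \row_i oapp (p.2 0) p.1 (unlift ord0 i).

Let rV_uncons n (v : 'rV[R]_n.+1) : R * 'rV[R]_n :=
  (v 0 0, \row_j v 0 (lift ord0 j)).

Let rV_consK n : cancel (@rV_cons n) (@rV_uncons n).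
Proof.
case=> a v; congr pair; first by rewrite mxE unlift_none.
by apply/rowP => j; rewrite !mxE liftK.
Qed.

Lemma measurable_rV_cons n : measurable_fun setT (@rV_cons n).
Proof.
apply/measurable_fun_mxP => i j; under eq_fun do rewrite mxE.
case: unliftP => [k _|_] /=; last exact: measurable_fst.
exact: (measurableT_comp (measurable_entry 0 k) measurable_snd).
Qed.

Let measurable_rV_uncons n : measurable_fun setT (@rV_uncons n).
Proof.
apply: measurable_fun_pair; first exact: measurable_entry.
apply/measurable_fun_mxP => i j; under eq_fun do rewrite mxE.
exact: measurable_entry.
Qed.

Section step.
Variables (n : nat) (mu : {sigma_finite_measure set 'rV[R]_n -> \bar R}).

Definition lebesgue_step : set 'rV[R]_n.+1 -> \bar R :=
  pushforward (@lebesgue_measure R \x mu)%E (@rV_cons n).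


Let step0 : lebesgue_step set0 = 0%E.
Proof. by rewrite /lebesgue_step /pushforward preimage_set0 measure0. Qed.

Let step_ge0 A : (0 <= lebesgue_step A)%E.
Proof. by rewrite /lebesgue_step /pushforward; exact: measure_ge0. Qed.

Let step_sigma_additive : semi_sigma_additive lebesgue_step.
Proof.
have mC A : measurable A -> measurable (@rV_cons n @^-1` A).
  by move=> mA; rewrite -[X in measurable X]setTI; exact: measurable_rV_cons.
move=> F mF tF mUF; rewrite /lebesgue_step /pushforward preimage_bigcup.
apply: measure_semi_sigma_additive.
- by move=> k; exact: mC.
- apply/trivIsetP => /= i j _ _ ij; rewrite -preimage_setI.
  by move/trivIsetP : tF => /(_ _ _ _ _ ij) ->//; rewrite preimage_set0.
- by rewrite -preimage_bigcup; exact: mC.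
Qed.

HB.instance Definition _ := isMeasure.Build _ _ _ lebesgue_step
  step0 step_ge0 step_sigma_additive.

Let step_sigma_finite : sigma_finite setT lebesgue_step.
Proof.
have /sigma_finiteP[F [TF ndF Foo]] := sigma_finiteT (@lebesgue_measure R).
have /sigma_finiteP[G [TG ndG Goo]] := sigma_finiteT mu.
exists (fun k => @rV_uncons n @^-1` (F k `*` G k)).
  rewrite -preimage_bigcup -[LHS](preimage_setT (@rV_uncons n)); congr (_ @^-1` _).
  rewrite -setXTT TF TG predeqE => -[x y]; split.
    move=> [/= [p _ Fpx] [k _ Gky]]; exists (maxn p k) => //; split.
    - by move: x Fpx; exact/subsetPset/ndF/leq_maxl.
    - by move: y Gky; exact/subsetPset/ndG/leq_maxr.
  by move=> [p _ []/= ? ?]; split; exists p.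
move=> k; have [mF Fk] := Foo k; have [mG Gk] := Goo k; split.
  rewrite -[X in measurable X]setTI; apply: measurable_rV_uncons => //.
  exact: measurableX.
rewrite /lebesgue_step /pushforward -comp_preimage.
rewrite (_ : _ \o _ = id) ?preimage_id; last first.
  by apply/funext => p; exact: rV_consK.
by rewrite product_measure1E// lte_mul_pinfty// ge0_fin_numE.
Qed.

HB.instance Definition _ := Measure_isSigmaFinite.Build _ _ _ lebesgue_step
  step_sigma_finite.

End step.

(* Lebesgue measure on R^n, as the n-fold product of the one on R. *)
Fixpoint lebesgue_rV n : {sigma_finite_measure set 'rV[R]_n -> \bar R} :=
  match n with
  | 0 => \d_(0 : 'rV[R]_0)
  | n'.+1 => lebesgue_step (lebesgue_rV n')
  end.

Lemma lebesgue_rV_box n (A : 'I_n -> set R) :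
  (forall i, measurable (A i)) ->
  lebesgue_rV n [set v | forall i, A i (v 0 i)] =
  (\prod_(i < n) lebesgue_measure (A i))%E.
Proof.
elim: n A => [|n IH] A mA.
  rewrite big_ord0 /= diracE mem_set//; by case.
rewrite big_ord_recl -IH//.
pose B := [set v : 'rV[R]_n | forall i : 'I_n, A (lift ord0 i) (v 0 i)].
have mB : measurable B.
  rewrite (_ : B = \bigcap_(i in setT)
      ((fun v : 'rV[R]_n => v 0 i) @^-1` A (lift ord0 i))); last first.
    by apply/seteqP; split => v /= h i; [move=> _; exact: h|exact: (h i I)].
  apply: fin_bigcap_measurable => // i _.
  by rewrite -[X in measurable X]setTI; exact: measurable_entry.
transitivity ((@lebesgue_measure R \x lebesgue_rV n)%E (A ord0 `*` B)); last first.
  by rewrite product_measure1E//; exact: mA.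
congr (product_measure1 _ _ _); apply/seteqP; split => -[a v] /=.
  move=> h; split=> [|i].
    by have := h ord0; rewrite mxE unlift_none.
  by have := h (lift ord0 i); rewrite mxE liftK.
by case=> h0 h i; rewrite mxE; case: unliftP => [j|] ->.
Qed.
End lebesgue_rV.

Section euclidean.
Context {R : realType}.

(* The library's norm on row vectors is the sup norm. *)
Definition enorm d (v : 'rV[R]_d) : R := Num.sqrt (\sum_i v 0 i ^+ 2).

Definition gradient d (u : 'rV[R]_d -> R) (x : 'rV[R]_d) : 'rV[R]_d :=
  \row_i 'D_(delta_mx 0 i) u x.

Definition sub_gaussian d (mu : probability 'rV[R]_d R) : Prop :=
  exists C a : R, [/\ 0 < C, 0 < a & forall r : R, 0 <= r ->
    (mu [set x | r <= enorm x]%R <= (C * expR (- (a * r ^+ 2)))%:E)%E].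

End euclidean.

Section conditioning.
Context {R : realType} {dO : measure_display} {Omega : measurableType dO}.
Variable P : probability Omega R.

(* Z is a version of the conditional probability of A given the
   sub-sigma-algebra G *)
Definition cond_prob (G : set (set Omega)) (A : set Omega) (Z : Omega -> R) :
    Prop :=
  [/\ forall B, measurable B -> G (Z @^-1` B),
      P.-integrable setT (EFin \o Z) &
      forall B, G B -> (\int[P]_(w in B) (Z w)%:E)%E = P (A `&` B)].

(* Given G, the random vector Y has the (G-dependent) density q. *)
Definition cond_density d (G : set (set Omega)) (Y : Omega -> 'rV[R]_d)
    (q : Omega -> 'rV[R]_d -> R) : Prop :=
  forall A, measurable A ->
    cond_prob G (Y @^-1` A) (fun w => \int[lebesgue_rV d]_(y in A) q w y).

Definition mutually_independent (I : finType) (d : measure_display)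
    (E : measurableType d) (Y : I -> Omega -> E) : Prop :=
  forall (J : {set I}) (A : I -> set E), (forall i, measurable (A i)) ->
    P (\bigcap_(i in [set` J]) (Y i @^-1` A i)) =
    (\prod_(i in J) P (Y i @^-1` A i))%E.

Definition cond_mutually_independent (G : set (set Omega)) (I : finType)
    (d : measure_display) (E : measurableType d) (Y : I -> Omega -> E) : Prop :=
  forall (J : {set I}) (A : I -> set E) (Z : I -> Omega -> R),
    (forall i, measurable (A i)) ->
    (forall i, i \in J -> cond_prob G (Y i @^-1` A i) (Z i)) ->
    cond_prob G (\bigcap_(i in [set` J]) (Y i @^-1` A i))
      (fun w => \prod_(i in J) Z i w).

Definition trajectory (E : Type) (N : nat) (X : nat -> Omega -> E) (w : Omega) :
    N.+1.-tuple E :=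
  [tuple X i w | i < N.+1].

Definition independent_copies (M N : nat) d (E : measurableType d)
    (X : nat -> Omega -> E) (Xs : 'I_M -> nat -> Omega -> E) : Prop :=
  mutually_independent (fun s => trajectory N (Xs s)) /\
  forall s (B : set (N.+1.-tuple E)), measurable B ->
    P (trajectory N (Xs s) @^-1` B) = P (trajectory N X @^-1` B).

End conditioning.

(* S collects k of the points p_1, ..., p_M nearest to z; S need not be
   unique, since points may be at equal distance from z. *)
Definition is_nearest_set (R : realType) (d M k : nat) (p : M.-tuple 'rV[R]_d)
    (z : 'rV[R]_d) (S : {set 'I_M}) : Prop :=
  #|S| = k /\
  forall s s', s \in S -> s' \notin S ->
    enorm (tnth p s - z) <= enorm (tnth p s' - z).

(* nn is a nearest-neighbour rule: ties are broken in any measurable way. *)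
Definition nearest_neighbour_rule (R : realType) (d M k : nat)
    (nn : M.-tuple 'rV[R]_d -> 'rV[R]_d -> {set 'I_M}) : Prop :=
  (forall p z, is_nearest_set k p z (nn p z)) /\
  forall S : {set 'I_M},
    measurable [set q : M.-tuple 'rV[R]_d * 'rV[R]_d | nn q.1 q.2 = S].

Definition grid (R : realType) (T : R) (N n : nat) : R := n%:R * (T / N%:R).

Definition switching_costs (R : realType) (d D : nat) (T : R)
    (c : 'I_D -> 'I_D -> R -> 'rV[R]_d -> R) : Prop :=
  forall t x, 0 <= t <= T ->
  [/\ forall i, c i i t x = 0,
      forall i j, i != j -> 0 < c i j t x &
      forall i j l, i != j -> j != l -> i != l ->
        c i l t x <= c i j t x + c j l t x].

(* For n < N, the function y |-> rho x t_n y (t_n + dt) is a probability density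
   for each x. *)
Definition transition_density (R : realType) (d N : nat) (T : R)
    (rho : 'rV[R]_d -> R -> 'rV[R]_d -> R -> R) : Prop :=
  forall n, (n < N)%N ->
  [/\ measurable_fun setT (fun p : 'rV[R]_d * 'rV[R]_d =>
        rho p.1 (grid T N n) p.2 (grid T N n + T / N%:R)),
      forall x y, 0 <= rho x (grid T N n) y (grid T N n + T / N%:R) &
      forall x, (\int[lebesgue_rV d]_y
        (rho x (grid T N n) y (grid T N n + T / N%:R))%:E)%E = 1%E].

(* X_0, ..., X_N is a Markov process with initial law mu0 and transition
   densities rho *)
Definition markov_process (R : realType) dO (Omega : measurableType dO)
    (P : probability Omega R) (d N : nat) (T : R)
    (mu0 : probability 'rV[R]_d R) (rho : 'rV[R]_d -> R -> 'rV[R]_d -> R -> R)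
    (X : nat -> Omega -> 'rV[R]_d) : Prop :=
  (forall A, measurable A -> P (X 0 @^-1` A) = mu0 A) /\
  forall n, (n < N)%N ->
    cond_density P (sigma_gen [set l | (l <= n)%N] X) (X n.+1)
      (fun w y => rho (X n w) (grid T N n) y (grid T N n + T / N%:R)).

(* Given the sampled trajectories, the one-step transitions Xt n s h started
   from Xs s n, n < N, are independent and distributed according to rho. *)
Definition one_step_samples (R : realType) dO (Omega : measurableType dO)
    (P : probability Omega R) (d M N mY : nat) (T : R)
    (rho : 'rV[R]_d -> R -> 'rV[R]_d -> R -> R)
    (Xs : 'I_M -> nat -> Omega -> 'rV[R]_d)
    (Xt : nat -> 'I_M -> 'I_mY -> Omega -> 'rV[R]_d) : Prop :=
  let G := sigma_gen [set sl : 'I_M * nat | (sl.2 <= N)%N]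
    (fun sl => Xs sl.1 sl.2) in
  cond_mutually_independent P G
    (fun nsh : 'I_N * 'I_M * 'I_mY => Xt nsh.1.1 nsh.1.2 nsh.2) /\
  forall n s h, (n < N)%N ->
    cond_density P G (Xt n s h)
      (fun w y => rho (Xs s n w) (grid T N n) y (grid T N n + T / N%:R)).

Section estimators.
Context {R : realType} {d D M mY : nat}.
Variables (N k : nat) (T : R).
Variables (f : 'I_D -> R -> 'rV[R]_d -> R).
Variables (c : 'I_D -> 'I_D -> R -> 'rV[R]_d -> R).
Variable rho : 'rV[R]_d -> R -> 'rV[R]_d -> R -> R.
Variable C0 : nat -> R.
Variable nn : nat -> M.-tuple 'rV[R]_d -> 'rV[R]_d -> {set 'I_M}.
(* a realization of the data: trajectories and one-step transitions *)
Variables (x : 'I_M -> nat -> 'rV[R]_d) (xt : nat -> 'I_M -> 'I_mY -> 'rV[R]_d).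

Definition g_tilde (n : nat) (V : 'rV[R]_d -> R) (z : 'rV[R]_d) : R :=
  (k * mY)%:R^-1 *
  \sum_(s in nn n [tuple x s n | s < M] z) \sum_(h < mY) V (xt n s h).

Definition g_hat (n : nat) (V : 'rV[R]_d -> R) (z : 'rV[R]_d) : R :=
  Num.sg (g_tilde n V z) *
  Num.min `|g_tilde n V z| (2 * C0 n * (enorm z + 1)).

Definition g_exact (n : nat) (V : 'rV[R]_d -> R) (z : 'rV[R]_d) : R :=
  \int[lebesgue_rV d]_y (V y * rho z (grid T N n) y (grid T N n + T / N%:R)).

(* max_j [dt f_j(t_n, z) - c_ij(t_n, z) + G_j]; the iterated maximum is seeded
   with the term j = i since R has no least element. *)
Definition best_switch (n : nat) (G : 'I_D -> R) (i : 'I_D) (z : 'rV[R]_d) : R :=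
  let F j := T / N%:R * f j (grid T N n) z - c i j (grid T N n) z + G j in
  \big[Num.max/F i]_(j < D) F j.

(* the estimator m steps before the final time *)
Fixpoint V_back (m : nat) : 'I_D -> 'rV[R]_d -> R :=
  match m with
  | 0 => fun _ _ => 0
  | m'.+1 => fun i z =>
      let n := (N - m'.+1)%N in
      best_switch n (fun j => g_hat n (V_back m' j) z) i z
  end.

Definition V_hat (n : nat) : 'I_D -> 'rV[R]_d -> R := V_back (N - n).

Definition V_tilde (n : nat) (i : 'I_D) (z : 'rV[R]_d) : R :=
  best_switch n (fun j => g_exact n (V_hat n.+1 j) z) i z.

Lemma V_hatN i z : V_hat N i z = 0.
Proof. by rewrite /V_hat subnn. Qed.

Lemma V_hatE n i z : (n < N)%N ->
  V_hat n i z = best_switch n (fun j => g_hat n (V_hat n.+1 j) z) i z.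
Proof.
by move=> nN; rewrite /V_hat -(subnSK nN)/= subnSK// subKn// ltnW.
Qed.

End estimators.

(* Main.v *)
(* Truncation by 2 C0 (|x| + 1), where C0 (|z| + 1) bounds the exact conditional
   mean g(z), makes the event empty (up to a null set) for delta > C2, so only
   radii r = delta / (4 C2) <= 1/4 matter. For those, split g~(x) - g(x) into
   - the bias, an average of g(X^s) - g(x) over the k nearest neighbours: at most
     delta / 4 when they all lie within r of x, since g is Lipschitz near x by the
     gradient bound on rho; a neighbour lies farther than r only if at least M - k of
     the M points do, which Chernoff's inequality controls;
   - the average of the k m_Y terms V(X~^{s,h}) - g(X^s): given everything but
     X~^{s,h}, such a term is centred and, by the Gaussian bound on rho and the linear
     growth of V, sub-Gaussian uniformly over |X^s - x| <= 1. The exponential moment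
     of the sum is bounded by integrating out one transition at a time, and
     Markov's inequality concludes. *)
Require Import Defs.
From HB Require Import structures.
From mathcomp Require Import all_boot all_order all_algebra.
From mathcomp Require Import all_classical all_reals all_analysis.
From mathcomp Require Import measurable_realfun zify ring lra.

Set Implicit Arguments.
Unset Strict Implicit.
Unset Printing Implicit Defensive.

Import Order.TTheory GRing.Theory Num.Theory.
Import numFieldNormedType.Exports.

Local Open Scope classical_set_scope.
Local Open Scope ring_scope.

(** * Integration against a density *)

(** The obstacle is the dependence between the summands. Conditional independence is available only
    as an identity between versions of conditional probabilities of events given the trajectories,
    whereas the summands share random functions, the next value and its mean, both built from later
    transitions. Integrating out one transition therefore requires that, given the trajectories and
    all the other transitions, it still has density [rho]. This is [freezing]: an identity checked
    on a pi-system of rectangles and extended by uniqueness of finite measures. Two more points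
    shape the argument. The set of neighbours is random but determined by the trajectories, so the
    exponential moment is a product over all samples, with factor 1 for those that are not
    neighbours. The bound on one factor is available only for starting points near [x], so the
    indicator that all neighbours are close is carried through the whole integration. All constants
    are uniform in the outcome: Gaussian integrals do not depend on their centre, and the random
    value function enters only through its growth bound. *)

Section density.
Local Open Scope ereal_scope.
Context d1 d2 (S : measurableType d1) (T : measurableType d2) (R : realType).
Variables (nu : {measure set S -> \bar R}) (mu : {measure set T -> \bar R}).
Variables (phi : T -> S) (h : T -> R).
Hypotheses (mphi : measurable_fun setT phi) (mh : measurable_fun setT h).
Hypothesis h0 : forall x, (0 <= h x)%R.

Import HBNNSimple.

(** Linearity and monotone convergence carry the identity from indicators to nonnegative functions.
    A map [phi] is combined with the density because it will be the identity of a set, seen as a map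
    to a coarser sigma-algebra on that set. *)
Lemma ge0_integral_density (F : S -> \bar R) :
  (forall B, measurable B ->
    nu B = \int[mu]_x ((h x)%:E * (\1_B (phi x))%:E)) ->
  measurable_fun setT F ->
  (forall s, 0 <= F s) -> \int[nu]_s F s = \int[mu]_x ((h x)%:E * F (phi x)).
Proof.
move=> nuE mF F0; pose f_ := nnsfun_approx measurableT mF.
have fF s : limn (EFin \o (f_ ^~ s)) = F s.
  by apply/cvg_lim => //; exact: cvg_nnsfun_approx.
have f_nd s m n : (m <= n)%N -> (f_ m s <= f_ n s)%R.
  by move=> mn; exact/lefP/nd_nnsfun_approx.
have fE n : \int[nu]_s (f_ n s)%:E = \int[mu]_x ((h x)%:E * (f_ n (phi x))%:E).
  under eq_integral => s _ do rewrite fimfunE -fsumEFin//.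
  rewrite ge0_integral_fsum//; last 2 first.
  - by move=> k; apply/measurable_EFinP/measurable_funM => //; exact: measurable_indic.
  - by move=> k s _; exact: nnfun_muleindic_ge0.
  under [RHS]eq_integral => x _.
    rewrite fimfunE -fsumEFin//.
    rewrite ge0_mule_fsumr; last by move=> k; exact: nnfun_muleindic_ge0.
    over.
  rewrite ge0_integral_fsum//; last 2 first.
  - move=> k; apply: emeasurable_funM; apply/measurable_EFinP => //.
    apply: measurable_funM => //.
    by apply: (measurableT_comp _ mphi); exact: measurable_indic.
  - move=> k x _; apply: mule_ge0; first by rewrite lee_fin.
    by rewrite EFinM; exact: nnfun_muleindic_ge0.
  apply: eq_fsbigr => k /[!inE] -[s _ <-].
  under eq_integral do rewrite EFinM.
  rewrite ge0_integralZl//; last 2 first.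
  - by apply/measurable_EFinP; exact: measurable_indic.
  - by rewrite lee_fin.
  rewrite integral_indic// setIT nuE//.
  rewrite -ge0_integralZl//; last 3 first.
  - apply: emeasurable_funM; apply/measurable_EFinP => //.
    by apply: (measurableT_comp _ mphi); exact: measurable_indic.
  - by move=> x _; rewrite mule_ge0// lee_fin.
  - by rewrite lee_fin.
  by apply: eq_integral => x _; rewrite EFinM muleCA.
transitivity (limn (fun n => \int[nu]_s (f_ n s)%:E)).
  rewrite -monotone_convergence//.
  - by apply: eq_integral => s _; rewrite -fF.
  - by move=> n; exact/measurable_EFinP/measurable_funP.
  - by move=> n s _; rewrite lee_fin.
  - by move=> s _ m n mn; rewrite lee_fin f_nd.
under eq_fun do rewrite fE.
rewrite -monotone_convergence//.
- apply: eq_integral => x _; apply/cvg_lim => //; apply: cvgeZl => //.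
  exact: cvg_nnsfun_approx.
- move=> n; apply/measurable_EFinP/measurable_funM => //.
  by apply: (measurableT_comp _ mphi); exact: measurable_funP.
- by move=> n x _; rewrite mule_ge0// lee_fin.
- by move=> x _ m n mn; rewrite lee_wpmul2l ?lee_fin// f_nd.
Qed.
(** The right-hand side, as a function of the set [B], is itself a measure [M2]. It agrees with the
    finite measure [nu] on a generating pi-system that contains the whole space, hence
    everywhere. *)
Lemma ge0_integral_density_pi_system (G : set (set S)) :
  @measurable _ S = <<s G >> -> setI_closed G -> G setT ->
  nu setT < +oo ->
  (forall B, G B -> nu B = \int[mu]_x ((h x)%:E * (\1_B (phi x))%:E)) ->
  forall F : S -> \bar R, measurable_fun setT F -> (forall s, 0 <= F s) ->
  \int[nu]_s F s = \int[mu]_x ((h x)%:E * F (phi x)).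
Proof.
move=> mG GI GT nuT nuG.
pose m2 (B : set S) := \int[mu]_(x in phi @^-1` B) (h x)%:E.
have mphiB B : measurable B -> measurable (phi @^-1` B).
  by move=> mB; rewrite -[X in measurable X]setTI; exact: mphi.
have m2E B : m2 B = \int[mu]_x ((h x)%:E * (\1_B (phi x))%:E).
  rewrite /m2 integral_mkcond epatch_indic.
  by apply: eq_integral => x _ /=; rewrite !indicE.
have m20 : m2 set0 = 0 by rewrite /m2 preimage_set0 integral_set0.
have m2_ge0 B : 0 <= m2 B by apply: integral_ge0 => x _; rewrite lee_fin.
have m2_sigma : semi_sigma_additive m2.
  move=> F mF tF mUF; rewrite /m2 preimage_bigcup.
  apply: (@semi_sigma_additive_nng_induced _ _ _ mu (EFin \o h)).
  - exact/measurable_EFinP.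
  - by move=> x; rewrite lee_fin.
  - by move=> k; exact: mphiB.
  - apply/trivIsetP => /= i j _ _ ij; rewrite -preimage_setI.
    by move/trivIsetP : tF => /(_ _ _ _ _ ij) ->//; rewrite preimage_set0.
  - by rewrite -preimage_bigcup; exact: mphiB.
pose M2 : {measure set S -> \bar R} :=
  HB.pack m2 (isMeasure.Build _ _ _ m2 m20 m2_ge0 m2_sigma).
move=> F mF F0; apply: ge0_integral_density => // B mB; rewrite -m2E.
apply: (@measure_unique _ _ _ G (fun=> setT) mG GI _ _ nu M2) => //.
- by rewrite bigcup_const//; exists O.
- by move=> A GA; rewrite nuG// -m2E.
Qed.
End density.

Section cond_prob_pull_out.
Local Open Scope ereal_scope.
Context (R : realType) dO (Omega : measurableType dO) (P : probability Omega R).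

(** The measure [B |-> P (A]&[B)] on the sigma-algebra generated by [GG] has two densities with
    respect to [P]: the indicator of [A], and [Z] by definition of conditional probability. Both
    sides integrate [U] against it. *)
Lemma cond_prob_pull_out (GG : set (set Omega)) (A : set Omega) (Z U : Omega -> R) :
  <<s GG >> `<=` measurable -> measurable A -> cond_prob P <<s GG >> A Z ->
  (forall w, (0 <= Z w)%R) ->
  (forall B, measurable B -> <<s GG >> (U @^-1` B)) -> (forall w, (0 <= U w)%R) ->
  \int[P]_w ((\1_A w)%:E * (U w)%:E) = \int[P]_w ((Z w)%:E * (U w)%:E).
Proof.
move=> GGm mA [_ iZ ZE] Z0 mU U0.
pose S := g_sigma_algebraType GG; pose phi : Omega -> S := id.
have mphi : measurable_fun setT phi by move=> _ B mB; rewrite setTI; exact: GGm.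
have mZ : measurable_fun setT Z by apply/measurable_EFinP; exact: measurable_int iZ.
have mUS : measurable_fun setT (fun s : S => (U s)%:E).
  by apply/measurable_EFinP => _ B mB; rewrite setTI; exact: mU.
pose nu := pushforward (mrestr P mA) phi.
have U0' : forall s : S, 0 <= (U s)%:E by move=> s; rewrite lee_fin.
have nuE B : measurable B -> nu B = \int[P]_w ((\1_A w)%:E * (\1_B (phi w))%:E).
  move=> mB; rewrite /nu /pushforward /mrestr setIC.
  rewrite -[in LHS](setIT (A `&` _)) -integral_indic//; last first.
    by apply: measurableI => //; exact: GGm.
  by apply: eq_integral => w _; rewrite indicI/= EFinM.
rewrite -(ge0_integral_density mphi _ _ nuE mUS U0')//.
rewrite -(ge0_integral_density (nu := nu) mphi mZ Z0 _ mUS U0')//.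
move=> B mB; transitivity (P (A `&` B)); first by rewrite setIC.
rewrite -ZE// [LHS]integral_mkcond epatch_indic.
by apply: eq_integral => w _ /=.
Qed.
End cond_prob_pull_out.

(** * Conditioning on all the samples but one *)

Section freezing.
Local Open Scope ereal_scope.
Context (R : realType) dO (Omega : measurableType dO) (P : probability Omega R).
Context d (E : measurableType d) (leb : {sigma_finite_measure set E -> \bar R}).
Context (K : finType) (Y : K -> Omega -> E) (GG : set (set Omega)) (i0 : K).

(* These generate the sigma-algebra on Omega * E of the events that depend on GG,
   on the Y i with i != i0 (whence A i0 = setT) and on the second coordinate. *)
Definition except_sets : set (set (Omega * E)) :=
  [set S | exists B (A : K -> set E) C, [/\ <<s GG >> B,
    forall i, measurable (A i), A i0 = setT, measurable C &
    S = (B `&` \bigcap_(i in [set: K]) (Y i @^-1` A i)) `*` C]].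

Definition exceptType := g_sigma_algebraType except_sets.

Let GGT : <<s GG >> setT.
Proof. exact: (@measurableT _ (g_sigma_algebraType GG)). Qed.

Lemma measurable_except_gen d' (T : measurableType d') (U : Omega -> T) :
  (forall B, measurable B -> <<s GG >> (U @^-1` B)) ->
  measurable_fun setT (fun p : exceptType => U p.1).
Proof.
move=> mU _ B mB; rewrite setTI; apply: sub_sigma_algebra.
exists (U @^-1` B), (fun=> setT), setT; split => //; first exact: mU.
by apply/seteqP; split => -[w y] /=; [move=> h; split|case=> -[]].
Qed.

Lemma measurable_except_neq i : i != i0 ->
  measurable_fun setT (fun p : exceptType => Y i p.1).
Proof.
move=> ii0 _ B mB; rewrite setTI; apply: sub_sigma_algebra.
exists setT, (fun j => if j == i then B else setT), setT; split => //.
- by move=> j; case: ifP.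
- by rewrite eq_sym (negbTE ii0).
apply/seteqP; split => -[w y] /=.
  by move=> BY; split => //; split => // j _; case: eqVneq => [->|].
by move=> [[_ /(_ i I)]]; rewrite eqxx.
Qed.

Lemma measurable_except_snd : measurable_fun setT (fun p : exceptType => p.2).
Proof.
move=> _ B mB; rewrite setTI; apply: sub_sigma_algebra.
exists setT, (fun=> setT), B; split => //.
by apply/seteqP; split => -[w y] /=; [move=> h; split|case=> -[]].
Qed.

Hypothesis GGm : <<s GG >> `<=` measurable.
Hypothesis mY : forall i, measurable_fun setT (Y i).

Let mYB i B : measurable B -> measurable (Y i @^-1` B).
Proof. by move=> mB; rewrite -[X in measurable X]setTI; exact: mY. Qed.

Let mYcap (A : K -> set E) : (forall i, measurable (A i)) ->
  measurable (\bigcap_(i in [set: K]) (Y i @^-1` A i)).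
Proof.
by move=> mA; apply: fin_bigcap_measurable => // i _; exact: mYB.
Qed.

(** With the two projections, this says that the sigma-algebra of [exceptType] is coarser than the
    product one; with the identity and [Y i0], it makes [w |-> (w, Y i0 w)] a map whose law can be
    computed. *)
Lemma measurable_to_except d' (T : measurableType d') (u : T -> Omega) (v : T -> E) :
  measurable_fun setT u -> measurable_fun setT v ->
  measurable_fun setT (fun t => (u t, v t) : exceptType).
Proof.
move=> mu mv.
apply: (@measurability _ _ T (g_sigma_algebraType except_sets) setT _ except_sets) => //.
move=> _ [_ [B [A [C [GB mA _ mC ->]]]] <-].
apply: measurableI => //.
rewrite [X in measurable X](_ : _ =
  u @^-1` (B `&` \bigcap_(i in [set: K]) (Y i @^-1` A i)) `&` v @^-1` C)//.
apply: measurableI.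
- rewrite -[X in measurable X]setTI; apply: mu => //.
  by apply: measurableI; [exact: GGm|exact: mYcap].
- by rewrite -[X in measurable X]setTI; exact: mv.
Qed.

Let except_setsI : setI_closed except_sets.
Proof.
move=> _ _ [B [A [C [GB mA A0 mC ->]]]] [B' [A' [C' [GB' mA' A0' mC' ->]]]].
exists (B `&` B'), (fun i => A i `&` A' i), (C `&` C'); split.
- have := @measurableI _ (g_sigma_algebraType GG) B B'; exact.
- by move=> i; exact: measurableI.
- by rewrite A0 A0' setIT.
- exact: measurableI.
- apply/seteqP; split => -[w y] /=.
    move=> [[[? h] ?] [[? h'] ?]]; split => //; split => // i _.
    by split; [exact: h|exact: h'].
  by move=> [[[? ?] h] [? ?]]; split; (split; [split => // i iT; case: (h i iT)|]).
Qed.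

Let except_setsT : except_sets setT.
Proof.
exists setT, (fun=> setT), setT; split => //.
by apply/seteqP; split => -[w y] /=.
Qed.

Hypothesis indep : cond_mutually_independent P <<s GG >> Y.
Hypothesis cond_probY : forall i A, measurable A ->
  exists2 Z, cond_prob P <<s GG >> (Y i @^-1` A) Z & forall w, (0 <= Z w)%R.

Variable q : Omega -> E -> R.
Hypothesis mq : measurable_fun setT (fun p : Omega * E => q p.1 p.2).
Hypothesis q0 : forall w y, (0 <= q w y)%R.
Hypothesis q1 : forall w, \int[leb]_y (q w y)%:E = 1.
Hypothesis Yq : forall A, measurable A ->
  cond_prob P <<s GG >> (Y i0 @^-1` A) (fun w => Rintegral leb A (q w)).

Let mqw w : measurable_fun setT (q w).
Proof. exact: (measurableT_comp mq (pair1_measurable w)). Qed.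

Let qE w A : measurable A ->
  (Rintegral leb A (q w))%:E = \int[leb]_y ((q w y)%:E * (\1_A y)%:E).
Proof.
move=> mA; rewrite /Rintegral fineK; last first.
  rewrite ge0_fin_numE; last by apply: integral_ge0 => y _; rewrite lee_fin.
  apply: (@le_lt_trans _ _ 1); last exact: ltry.
  rewrite -(q1 w); apply: ge0_subset_integral => //.
  - by apply/measurable_EFinP.
  - by move=> y _; rewrite lee_fin.
by rewrite integral_mkcond epatch_indic.
Qed.

(* The Y i being independent given GG, conditioning on the Y i with i != i0 in
   addition to GG does not change the conditional density of Y i0. *)
Let law_except (S : set (Omega * E)) : except_sets S ->
  P ((fun w => (w, Y i0 w)) @^-1` S) =
  \int[P \x leb]_p ((q p.1 p.2)%:E * (\1_S p)%:E).
Proof.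
move=> [B [A [C [GB mA A0 mC ->]]]].
set D := \bigcap_(i in [set: K]) (Y i @^-1` A i).
have mD : measurable D by exact: mYcap.
have mB : measurable B by exact: GGm.
have Zex i : exists Z, cond_prob P <<s GG >> (Y i @^-1` A i) Z /\
    forall w, (0 <= Z w)%R.
  by have [Z] := cond_probY i (mA i); exists Z.
have [Z /all_and2[ZE Z0]] := choice Zex.
(* Since [A i0] is the whole space, the slot [i0] is free to carry the event [Y i0 \in C], whose
   conditional probability is the integral of the density over [C]. *)
pose Z1 i := if i == i0 then (fun w => Rintegral leb C (q w)) else Z i.
pose A1 i := if i == i0 then C else A i.
pose U w := (\1_B w * Rintegral leb C (q w))%R.
have mA1 i : measurable (A1 i) by rewrite /A1; case: ifP.
have Z1E i : cond_prob P <<s GG >> (Y i @^-1` A1 i) (Z1 i).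
  by rewrite /A1 /Z1; case: eqVneq => [->|_]; [exact: Yq|exact: ZE].
have [_ _ capE] : cond_prob P <<s GG >>
    (\bigcap_(i in [set` [set: K]%SET]) (Y i @^-1` A1 i))
    (fun w => \prod_(i in [set: K]%SET) Z1 i w)%R by exact: indep.
have capCE : cond_prob P <<s GG >>
    (\bigcap_(i in [set` [set~ i0]%SET]) (Y i @^-1` A i))
    (fun w => \prod_(i in [set~ i0]%SET) Z i w)%R by exact: indep.
have DE : D = \bigcap_(i in [set` [set~ i0]%SET]) (Y i @^-1` A i).
  apply/seteqP; split => w h i /=; first by move=> _; exact: h.
  move=> _; have [->|ii0] := eqVneq i i0; first by rewrite A0.
  by apply: h; rewrite /= !inE.
rewrite -DE in capCE.
have -> : (fun w => (w, Y i0 w)) @^-1` ((B `&` D) `*` C) =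
    (\bigcap_(i in [set` [set: K]%SET]) (Y i @^-1` A1 i)) `&` B.
  apply/seteqP; split => w /=.
    move=> [[Bw Dw] Cw]; split => // i _; rewrite /A1.
    by case: eqVneq => [->//|_]; exact: Dw.
  move=> [h Bw]; split; last by have := h i0; rewrite /A1/= eqxx inE; exact.
  split => // i _; have := h i; rewrite /A1/= inE => /(_ isT).
  by case: eqVneq => [->|//]; rewrite A0.
rewrite -capE// integral_mkcond epatch_indic.
rewrite fubini_tonelli1; last 2 first.
- apply: emeasurable_funM; apply/measurable_EFinP => //.
  by apply: measurable_indic; apply: measurableX => //; exact: measurableI.
- by move=> p; rewrite mule_ge0 ?lee_fin.
(* [U] depends on the conditioning sigma-algebra only, and the product of the [Z i] with [i != i0]
   is a conditional probability of [D]. Pulling [U] out replaces the indicator of [D] by that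
   product, which completes the product of the [Z1 i]. *)
transitivity (\int[P]_w ((\1_D w)%:E * (U w)%:E)); last first.
  apply: eq_integral => w _; rewrite /fubini_F/= /U EFinM qE//.
  rewrite muleA -ge0_integralZl//; last 2 first.
  - by apply: emeasurable_funM; apply/measurable_EFinP => //; exact: measurable_indic.
  - by move=> y _; rewrite mule_ge0 ?lee_fin.
  apply: eq_integral => y _.
  rewrite muleCA; congr (_ * _); rewrite -!EFinM; congr EFin.
  rewrite !indicE classical_sets.in_setX classical_sets.in_setI/=.
  by rewrite -!natrM !mulnb [(w \in D) && _]andbC.
have [mU _ _] := Yq mC.
rewrite (cond_prob_pull_out (GG := GG) _ mD capCE)//.
- apply: eq_integral => w _; rewrite /U/= -!EFinM; congr EFin.
  rewrite (bigD1 i0) ?inE//= {1}/Z1 eqxx -mulrA mulrC -mulrA; congr (_ * (_ * _))%R.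
  apply: eq_big => [i|i]; first by rewrite !inE.
  by rewrite /Z1 => /andP[_ /negbTE ->].
- by move=> w; apply: prodr_ge0.
- move=> B' mB'.
  have mS : measurable_fun setT (U : g_sigma_algebraType GG -> R).
    apply: measurable_funM; first exact: measurable_indic.
    by move=> _ B2 mB2; rewrite setTI; exact: mU.
  by have := mS measurableT B' mB'; rewrite setTI.
- move=> w; rewrite /U mulr_ge0//.
  by apply: Rintegral_ge0 => y _.
Qed.

(** Being measurable on [exceptType], [F] cannot see [Y i0] through its first argument, so that
    averaging over [Y i0] means integrating the second argument against [q w]. Rectangles are the
    case treated by [law_except], and they form a pi-system. *)
Lemma freezing (F : Omega * E -> \bar R) :
  measurable_fun setT (F : exceptType -> \bar R) -> (forall p, 0 <= F p) ->
  \int[P]_w F (w, Y i0 w) = \int[P]_w \int[leb]_y ((q w y)%:E * F (w, y)).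
Proof.
move=> mF F0.
have mi : measurable_fun setT (fun p : Omega * E => p : exceptType).
  have := measurable_to_except measurable_fst measurable_snd.
  by apply: eq_measurable_fun => -[].
have mY0 : measurable_fun setT (fun w => (w, Y i0 w) : exceptType).
  exact: measurable_to_except.
transitivity (\int[pushforward P (fun w => (w, Y i0 w) : exceptType)]_p F p).
  by rewrite ge0_integral_pushforward.
have F0' : forall s : exceptType, 0 <= F s by [].
rewrite (ge0_integral_density_pi_system
  (nu := pushforward P (fun w => (w, Y i0 w) : exceptType))
  (mu := (P \x leb)%E) mi mq
  _ erefl except_setsI except_setsT _ _ mF F0')//.
- rewrite fubini_tonelli1//.
  apply: emeasurable_funM; first exact/measurable_EFinP.
  exact: (measurableT_comp mF mi).
  by move=> p; rewrite mule_ge0 ?lee_fin.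
- apply: (@le_lt_trans _ _ 1); last exact: ltry.
  exact: (probability_le1 P measurableT).
Qed.

End freezing.

(** * Gaussian bounds *)

Section enorm.
Context {R : realType}.
Implicit Types d : nat.

Lemma enorm_ge0 d (v : 'rV[R]_d) : 0 <= enorm v.
Proof. exact: sqrtr_ge0. Qed.

Lemma enormE d (v : 'rV[R]_d) : enorm v ^+ 2 = \sum_i v 0 i ^+ 2.
Proof. by rewrite sqr_sqrtr// sumr_ge0// => i _; exact: sqr_ge0. Qed.

Lemma enorm0_eq0 d (v : 'rV[R]_d) i : enorm v = 0 -> v 0 i = 0.
Proof.
move=> v0; have : \sum_i v 0 i ^+ 2 = 0 by rewrite -enormE v0 expr0n.
move/eqP; rewrite psumr_eq0 => [/allP/(_ i)|j _]; last exact: sqr_ge0.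
by rewrite mem_index_enum sqrf_eq0 => /(_ isT)/eqP.
Qed.

Lemma enorm_cauchy_schwarz d (u v : 'rV[R]_d) :
  `|\sum_i u 0 i * v 0 i| <= enorm u * enorm v.
Proof.
have [u0|u0] := eqVneq (enorm u) 0.
  rewrite u0 mul0r big1 ?normr0// => i _.
  by rewrite (enorm0_eq0 i u0) mul0r.
have [v0|v0] := eqVneq (enorm v) 0.
  rewrite v0 mulr0 big1 ?normr0// => i _.
  by rewrite (enorm0_eq0 i v0) mulr0.
have uv0 : 0 < enorm u * enorm v by rewrite mulr_gt0// lt_def enorm_ge0 ?u0 ?v0.
have H (s : R) : s ^+ 2 = 1 -> s * \sum_i u 0 i * v 0 i <= enorm u * enorm v.
  move=> s1; rewrite -(ler_pM2l uv0).
  have : 0 <= \sum_i (enorm v * u 0 i - s * enorm u * v 0 i) ^+ 2.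
    by rewrite sumr_ge0// => i _; exact: sqr_ge0.
  have -> : \sum_i (enorm v * u 0 i - s * enorm u * v 0 i) ^+ 2 =
      enorm v ^+ 2 * (\sum_i u 0 i ^+ 2) + s ^+ 2 * enorm u ^+ 2 * (\sum_i v 0 i ^+ 2)
      - 2 * s * enorm v * enorm u * \sum_i u 0 i * v 0 i.
    rewrite !mulr_sumr -big_split/= -sumrB; apply: eq_bigr => i _; ring.
  rewrite -!enormE s1; set w := \sum_i _; nra.
rewrite ler_norml; apply/andP; split.
  by have := H (-1); rewrite sqrrN expr1n mulN1r lerNl; apply.
by have := H 1; rewrite expr1n mul1r; apply.
Qed.

Lemma enormD d (u v : 'rV[R]_d) : enorm (u + v) <= enorm u + enorm v.
Proof.
rewrite -(@ler_pXn2r _ 2)// ?nnegrE ?addr_ge0 ?enorm_ge0//.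
rewrite sqrrD !enormE.
have := enorm_cauchy_schwarz u v; move/(le_trans (ler_norm _)).
rewrite (_ : \sum_i (u + v) 0 i ^+ 2 =
  \sum_i u 0 i ^+ 2 + 2 * (\sum_i u 0 i * v 0 i) + \sum_i v 0 i ^+ 2); first lra.
rewrite mulr_sumr -!big_split/=; apply: eq_bigr => i _; rewrite mxE; ring.
Qed.

Lemma enormN d (v : 'rV[R]_d) : enorm (- v) = enorm v.
Proof. by congr Num.sqrt; apply: eq_bigr => i _; rewrite mxE sqrrN. Qed.

Lemma enormZ d (a : R) (v : 'rV[R]_d) : enorm (a *: v) = `|a| * enorm v.
Proof.
rewrite /enorm -sqrtr_sqr -sqrtrM ?sqr_ge0//; congr Num.sqrt.
by rewrite mulr_sumr; apply: eq_bigr => i _; rewrite mxE exprMn.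
Qed.

Lemma measurable_enorm d : measurable_fun setT (@enorm R d).
Proof.
apply: (@measurableT_comp _ _ _ _ _ _ (@Num.sqrt R)).
  by apply: continuous_measurable_fun; exact: sqrt_continuous.
apply: measurable_sum => i.
by apply: measurable_funX; exact: measurable_entry.
Qed.

Lemma measurable_funB_mx disp (T : measurableType disp) d (u v : T -> 'rV[R]_d) :
  measurable_fun setT u -> measurable_fun setT v ->
  measurable_fun setT (fun t => u t - v t).
Proof.
move=> /measurable_fun_mxP mu /measurable_fun_mxP mv.
apply/measurable_fun_mxP => i j.
rewrite (_ : (fun _ => _) = (fun t => u t i j - v t i j)).
  exact: measurable_funB.
by apply/funext => t; rewrite !mxE.
Qed.

End enorm.

(** * Gaussian integrals over R^n *)

Section gauss.
Context {R : realType}.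

(** This is the normal density of variance 1/(2b) without its normalising factor. What matters later
    is not the value of [c] but that it does not depend on the centre. *)
Lemma integral_gauss1 (b : R) : 0 < b -> exists2 c : R, 0 < c & forall m : R,
  (\int[@lebesgue_measure R]_x (expR (- (b * (m - x) ^+ 2)))%:E)%E = c%:E.
Proof.
move=> b0; pose s := Num.sqrt ((2 * b)^-1).
have s2 : s ^+ 2 = (2 * b)^-1 by rewrite sqr_sqrtr// invr_ge0; lra.
have s0 : s != 0 by rewrite sqrtr_eq0 -ltNge invr_gt0; lra.
have p0 := normal_peak_gt0 s0.
exists (normal_peak s)^-1; first by rewrite invr_gt0.
move=> m; have := integral_normal_pdf m s; rewrite normal_pdfE//=.
under eq_integral => x _.
  rewrite /normal_fun s2.
  rewrite (_ : - (x - m) ^+ 2 / _ = - (b * (m - x) ^+ 2)); last by field; lra.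
  rewrite EFinM; over.
rewrite ge0_integralZl//; last 2 first.
- apply/measurable_EFinP; apply: measurableT_comp => //.
  apply: measurable_funN; apply: measurable_funM => //.
  by apply: measurable_funX; exact: measurable_funB.
- by rewrite lee_fin ltW.
move=> h; rewrite -[LHS]mul1e -[X in (X%:E * _)%E](mulVf (lt0r_neq0 p0)).
by rewrite EFinM -muleA h mule1.
Qed.

Lemma integral_gauss_rV (b : R) n : 0 < b -> exists2 c : R, 0 < c &
  forall z : 'rV[R]_n,
  (\int[lebesgue_rV n]_y (expR (- (b * enorm (z - y) ^+ 2)))%:E)%E = c%:E.
Proof.
move=> b0; have [c1 c10 c1E] := integral_gauss1 b0.
have mg m (z : 'rV[R]_m) :
    measurable_fun setT (fun y : 'rV[R]_m => (expR (- (b * enorm (z - y) ^+ 2)))%:E).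
  apply/measurable_EFinP; apply: measurableT_comp => //.
  apply: measurable_funN; apply: measurable_funM => //.
  apply: measurable_funX.
  apply: (measurableT_comp (@measurable_enorm R m)).
  exact: measurable_funB_mx.
elim: n => [|n [c c0 cE]].
  exists 1 => // z; rewrite [lebesgue_rV 0]/= integral_dirac//; last exact: mg.
  rewrite diracE mem_set// mul1e.
  by rewrite (_ : enorm _ = 0) ?expr0n/= ?mulr0 ?oppr0 ?expR0// /enorm big_ord0 sqrtr0.
exists (c1 * c); first exact: mulr_gt0.
move=> z.
transitivity (\int[pushforward (@lebesgue_measure R \x lebesgue_rV n)%E
    (@rV_cons R n)]_y (expR (- (b * enorm (z - y) ^+ 2)))%:E)%E.
  by apply: eq_measure_integral => [|mr A mA _]; [exact: measurable_rV_cons|].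
rewrite ge0_integral_pushforward//; [|exact: measurable_rV_cons|exact: mg].
rewrite preimage_setT fubini_tonelli1//; last 2 first.
- exact: (measurableT_comp (mg _ z) (@measurable_rV_cons R n)).
- by move=> p /=; rewrite lee_fin expR_ge0.
pose z' : 'rV[R]_n := \row_j z 0 (lift ord0 j).
transitivity (\int[@lebesgue_measure R]_x
    ((expR (- (b * (z 0 0 - x) ^+ 2)))%:E * c%:E))%E.
  apply: eq_integral => x _; rewrite -(cE z') -ge0_integralZl//; last exact: mg.
  apply: eq_integral => y _ /=; rewrite -EFinM -expRD; congr (expR _)%:E.
  rewrite !enormE big_ord_recl !mxE unlift_none/= mulrDr opprD.
  by congr (_ - b * _); apply: eq_bigr => i _; rewrite !mxE liftK.
rewrite ge0_integralZr// ?lee_fin ?(ltW c0)//.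
- by rewrite c1E -EFinM.
- apply/measurable_EFinP; apply: measurableT_comp => //.
  apply: measurable_funN; apply: measurable_funM => //.
  by apply: measurable_funX; exact: measurable_funB.
Qed.


End gauss.

(** * Elementary inequalities for the exponential *)

Section elementary.
Context {R : realType}.
Implicit Types x a b s th : R.

(** The linear term is kept exact so that it vanishes when a centred variable is inserted.
    Everything follows from [1 - x <= expR (- x)] and [1 + x <= expR x]. *)
Lemma expR_le_quadratic x : expR x <= 1 + x + x ^+ 2 * expR `|x|.
Proof.
have H (y : R) : expR y - 1 <= y * expR y.
  have := expR_ge1Dx (- y); have := expR_gt0 y; rewrite expRN.
  move=> ey; rewrite -(ler_pM2r ey) mulVf ?lt0r_neq0//; lra.
have [/ltW x0|x0] := ltP x 0.
  rewrite ler0_norm//.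
  have e1 : 1 <= expR (- x) by have := expR_ge1Dx (- x); lra.
  have := expR_ge1Dx x; have := H x; have := expR_gt0 x; nra.
rewrite ger0_norm//; have := H x; have := expR_gt0 x; nra.
Qed.

(** Squaring [expR (x / 2) <= 1 / (1 - x / 2)] leaves a polynomial inequality: (1 + x + 2x^2)(1 -
    x/2)^2 - 1 = x^2 (1 - x)(5 - 2x) / 4, which is nonnegative for x <= 1. *)
Lemma expR_le1 x : x <= 1 -> expR x <= 1 + x + 2 * x ^+ 2.
Proof.
move=> x1; have := expR_ge1Dx (- (x / 2)); rewrite expRN => h.
have e0 := expR_gt0 (x / 2).
have {}h : expR (x / 2) * (1 - x / 2) <= 1.
  by rewrite -(@ler_pM2r _ (expR (x / 2))^-1) ?invr_gt0// mulrAC mulfV ?lt0r_neq0// !mul1r.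
have -> : expR x = expR (x / 2) ^+ 2 by rewrite expr2 -expRD -splitr.
have h2 : (expR (x / 2) * (1 - x / 2)) ^+ 2 <= 1.
  by rewrite -[leRHS](expr1n _ 2) lerXn2r ?nnegrE//; nra.
rewrite exprMn in h2.
have y0 : 0 < (1 - x / 2) ^+ 2 by rewrite exprn_gt0//; lra.
rewrite -(ler_pM2r y0); apply: (le_trans h2).
have : 0 <= x ^+ 2 * ((1 - x) * (5 - 2 * x)).
  by apply: mulr_ge0; [exact: sqr_ge0|apply: mulr_ge0; lra].
nra.
Qed.

(** After centring, the two quadratic bounds average to 1 + 2 s^2 p (1 - p), and p (1 - p) <= 1/4.
    The exponent s^2 / 2 is weaker than Hoeffding's s^2 / 8 but gives exactly the rate M t^2 / 2 of
    the theorem; s <= 1 suffices since s will be a difference of two probabilities. *)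
Lemma bernoulli_mgf s (p : R) : 0 <= p <= 1 -> 0 <= s <= 1 ->
  1 + p * (expR s - 1) <= expR (s * p + s ^+ 2 / 2).
Proof.
move=> /andP[p0 p1] /andP[s0 s1].
rewrite expRD -ler_pdivrMl ?expR_gt0// -expRN.
have h1 : expR (- (s * p)) <= 1 - s * p + 2 * (s * p) ^+ 2.
  by have := @expR_le1 (- (s * p)); rewrite sqrrN; apply; nra.
have h2 : expR (s * (1 - p)) <= 1 + s * (1 - p) + 2 * (s * (1 - p)) ^+ 2.
  by apply: expR_le1; nra.
have h3 : 1 + s ^+ 2 / 2 <= expR (s ^+ 2 / 2) by exact: expR_ge1Dx.
have -> : expR (- (s * p)) * (1 + p * (expR s - 1)) =
    (1 - p) * expR (- (s * p)) + p * expR (s * (1 - p)).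
  by rewrite (_ : s * (1 - p) = - (s * p) + s) ?expRD; ring.
apply: le_trans h3.
have g1 : (1 - p) * expR (- (s * p)) <= (1 - p) * (1 - s * p + 2 * (s * p) ^+ 2).
  by apply: ler_wpM2l => //; lra.
have g2 : p * expR (s * (1 - p)) <= p * (1 + s * (1 - p) + 2 * (s * (1 - p)) ^+ 2).
  by apply: ler_wpM2l.
apply: (le_trans (lerD g1 g2)).
have -> : (1 - p) * (1 - s * p + 2 * (s * p) ^+ 2) +
   p * (1 + s * (1 - p) + 2 * (s * (1 - p)) ^+ 2) = 1 + 2 * s ^+ 2 * (p * (1 - p)) by ring.
have : 0 <= (p - 1 / 2) ^+ 2 by exact: sqr_ge0.
have : 0 <= s ^+ 2 by exact: sqr_ge0.
nra.
Qed.

Lemma linear_le_gauss b x : 0 < b -> 1 + x <= expR ((4 * b)^-1) * expR (b * x ^+ 2).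
Proof.
move=> b0; apply: (le_trans (expR_ge1Dx x)); rewrite -expRD ler_expR -subr_ge0.
have : 0 <= (2 * b * x - 1) ^+ 2 by exact: sqr_ge0.
move=> h.
have -> : (4 * b)^-1 + b * x ^+ 2 - x = (4 * b)^-1 * (2 * b * x - 1) ^+ 2.
  by field; lra.
by rewrite mulr_ge0// invr_ge0; lra.
Qed.

(** The exponent a x^2 is split in two halves: one absorbs the factor x^2 through [1 + y <= expR y],
    the other absorbs |th x| by completing the square. *)
Lemma sqr_expR_le a th x : 0 < a ->
  x ^+ 2 * expR `|th * x| <= 2 / a * expR (th ^+ 2 / (2 * a)) * expR (a * x ^+ 2).
Proof.
move=> a0.
have h1 : x ^+ 2 <= 2 / a * expR (a * x ^+ 2 / 2).
  rewrite -ler_pdivrMl ?divr_gt0//.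
  have := expR_ge1Dx (a * x ^+ 2 / 2).
  have -> : (2 / a)^-1 * x ^+ 2 = a * x ^+ 2 / 2 by field; lra.
  lra.
have h2 : expR `|th * x| <= expR (th ^+ 2 / (2 * a)) * expR (a * x ^+ 2 / 2).
  rewrite -expRD ler_expR normrM.
  have : 0 <= (`|th| - a * `|x|) ^+ 2 by exact: sqr_ge0.
  move=> h; rewrite -subr_ge0 -(real_normK (num_real th)) -(real_normK (num_real x)).
  have -> : `|th| ^+ 2 / (2 * a) + a * `|x| ^+ 2 / 2 - `|th| * `|x| =
    (2 * a)^-1 * (`|th| - a * `|x|) ^+ 2 by field; lra.
  by rewrite mulr_ge0// invr_ge0; lra.
apply: (le_trans (ler_pM _ _ h1 h2)); rewrite ?sqr_ge0 ?expR_ge0//.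
rewrite le_eqVlt; apply/orP; left; apply/eqP.
rewrite [X in _ = _ * expR X](_ : _ = a * x ^+ 2 / 2 + a * x ^+ 2 / 2); last by field.
rewrite expRD; ring.
Qed.

End elementary.

(** * Integrals dominated by a Gaussian *)

Section gaussian_domination.
Context {R : realType} (d : nat).
Local Notation leb := (lebesgue_rV d : {sigma_finite_measure set 'rV[R]_d -> \bar R}).
Implicit Types (V r q h : 'rV[R]_d -> R) (z : 'rV[R]_d).

Lemma gauss_dominated h b c K z : 0 <= K ->
  (\int[leb]_y (expR (- (b * enorm (z - y) ^+ 2)))%:E)%E = c%:E ->
  measurable_fun setT h ->
  (forall y, `|h y| <= K * expR (- (b * enorm (z - y) ^+ 2))) ->
  leb.-integrable setT (EFin \o h) /\ `|Rintegral leb setT h| <= K * c.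
Proof.
move=> K0 cE mh hK.
have mg : measurable_fun setT (fun y : 'rV[R]_d => expR (- (b * enorm (z - y) ^+ 2))).
  apply: measurableT_comp => //.
  apply: measurable_funN; apply: measurable_funM => //.
  apply: measurable_funX.
  apply: (measurableT_comp (@measurable_enorm R d)).
  exact: measurable_funB_mx.
have hle : (\int[leb]_y `|(h y)%:E| <= (K * c)%:E)%E.
  rewrite EFinM -cE -ge0_integralZl//; last exact/measurable_EFinP.
  apply: ge0_le_integral => //.
  - by apply/measurable_EFinP; apply: measurableT_comp.
  - by apply/measurable_EFinP; apply: measurable_funM.
  - by move=> y _ /=; rewrite -EFinM lee_fin.
have ih : leb.-integrable setT (EFin \o h).
  apply/integrableP; split; first exact/measurable_EFinP.
  exact: le_lt_trans hle (ltry _).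
split => //; rewrite -lee_fin EFin_normr_Rintegral//.
by apply: (le_trans _ hle); apply: le_abse_integral => //; exact/measurable_EFinP.
Qed.

Lemma linear_growth_gauss L b V y z : 0 <= L -> 0 < b ->
  (`|V y| <= L * (enorm y + 1)) ->
  `|V y| <= L * (enorm z + 1) * expR ((4 * b)^-1) * expR (b * enorm (z - y) ^+ 2).
Proof.
move=> L0 b0 /le_trans; apply; rewrite -!mulrA ler_wpM2l//.
apply: (@le_trans _ _ ((enorm z + 1) * (1 + enorm (z - y)))); last first.
  by apply: ler_wpM2l; [rewrite addr_ge0// enorm_ge0|exact: linear_le_gauss].
have : enorm y <= enorm z + enorm (z - y).
  by rewrite -(enormN (z - y)); apply: le_trans (enormD _ _); rewrite opprB addrC subrK.
have := enorm_ge0 z; have := enorm_ge0 (z - y); nra.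
Qed.

(** Half of the decay rate 2b of [r] pays for the linear growth of [V], the other half is
    integrated. Hence the Gaussian integrals at half of each available rate. *)
Lemma growth_gauss_integral L b c K V r z : 0 <= L -> 0 < b -> 0 <= K ->
  (\int[leb]_y (expR (- (b * enorm (z - y) ^+ 2)))%:E)%E = c%:E ->
  measurable_fun setT V -> measurable_fun setT r ->
  (forall y, `|V y| <= L * (enorm y + 1)) ->
  (forall y, `|r y| <= K * expR (- (2 * b * enorm (z - y) ^+ 2))) ->
  leb.-integrable setT (EFin \o (fun y => V y * r y)) /\
  `|Rintegral leb setT (fun y => V y * r y)| <=
    L * (enorm z + 1) * expR ((4 * b)^-1) * K * c.
Proof.
move=> L0 b0 K0 cE mV mr VL rK; apply: (gauss_dominated _ cE).
- by rewrite !mulr_ge0 ?expR_ge0// addr_ge0// enorm_ge0.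
- exact: measurable_funM.
- move=> y; rewrite normrM.
  apply: (le_trans (ler_pM _ _ (linear_growth_gauss z L0 b0 (VL y)) (rK y))) => //.
  rewrite le_eqVlt; apply/orP; left; apply/eqP.
  rewrite (_ : - (b * enorm (z - y) ^+ 2) =
    b * enorm (z - y) ^+ 2 - (2 * b * enorm (z - y) ^+ 2)); last ring.
  rewrite expRD; ring.
Qed.

(** First the moment of exp(a (V - g)^2) is bounded by [K]: as |V y - g| <= L |z - y| + B, the
    choice of [a] makes a (V - g)^2 at most l1/2 |z - y|^2 + 2 a B^2, which costs half of the decay
    of [q]. Such a moment controls the exponential of a centred variable for every real [th]. *)
Lemma subgaussian_mgf L l1 c B V q z g a K th : 0 < L -> 0 < l1 -> 0 <= c -> 0 <= B ->
  (\int[leb]_y (expR (- (l1 / 2 * enorm (z - y) ^+ 2)))%:E)%E = c%:E ->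
  measurable_fun setT V -> measurable_fun setT q ->
  (forall y, `|V y| <= L * (enorm y + 1)) ->
  (forall y, 0 <= q y) -> (\int[leb]_y (q y)%:E = 1)%E ->
  (forall y, q y <= l1^-1 * expR (- (l1 * enorm (z - y) ^+ 2))) ->
  g = Rintegral leb setT (fun y => V y * q y) ->
  L * (enorm z + 1) + `|g| <= B ->
  a = l1 / (4 * L ^+ 2) -> K = l1^-1 * expR (2 * a * B ^+ 2) * c ->
  (\int[leb]_y (expR (th * (V y - g)) * q y)%:E <=
    (expR ((1 / 2 + 2 * K) / a * th ^+ 2))%:E)%E.
Proof.
move=> L0 l10 c0 B0 cE mV mq VL q0 q1 qK gE gB aE KE.
have a0 : 0 < a by rewrite aE divr_gt0// mulr_gt0// exprn_gt0.
have K0 : 0 <= K by rewrite KE !mulr_ge0 ?invr_ge0 ?expR_ge0// ltW.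
pose w y := expR (a * (V y - g) ^+ 2) * q y.
have mw : measurable_fun setT w.
  apply: measurable_funM => //; apply: measurableT_comp => //.
  by apply: measurable_funM => //; apply: measurable_funX; exact: measurable_funB.
have wle y : `|w y| <= l1^-1 * expR (2 * a * B ^+ 2) * expR (- (l1 / 2 * enorm (z - y) ^+ 2)).
  rewrite ger0_norm ?mulr_ge0 ?expR_ge0//.
  apply: (le_trans (ler_wpM2l (expR_ge0 _) (qK y))).
  rewrite mulrCA -mulrA ler_wpM2l ?invr_ge0 ?(ltW l10)// -!expRD ler_expR.
  set e := enorm (z - y).
  have e0 : 0 <= e by exact: enorm_ge0.
  have hU : `|V y - g| <= L * e + B.
    apply: (le_trans (ler_normB _ _)).
    apply: (@le_trans _ _ (L * e + (L * (enorm z + 1) + `|g|))).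
      rewrite addrA lerD2r; apply: (le_trans (VL y)).
      rewrite -mulrDr ler_wpM2l ?(ltW L0)// addrA lerD2r.
      rewrite /e -(enormN (z - y)) addrC; apply: le_trans (enormD _ _).
      by rewrite opprB addrC subrK.
    by rewrite lerD2l.
  have hU2 : (V y - g) ^+ 2 <= 2 * (L * e) ^+ 2 + 2 * B ^+ 2.
    rewrite -(real_normK (num_real (V y - g))).
    have : `|V y - g| ^+ 2 <= (L * e + B) ^+ 2.
      by rewrite lerXn2r ?nnegrE// addr_ge0// mulr_ge0// ltW.
    move/le_trans; apply.
    have : 0 <= (L * e - B) ^+ 2 by exact: sqr_ge0.
    nra.
  have : a * (V y - g) ^+ 2 <= a * (2 * (L * e) ^+ 2 + 2 * B ^+ 2).
    by rewrite ler_wpM2l// ltW.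
  have -> : a * (2 * (L * e) ^+ 2 + 2 * B ^+ 2) = l1 / 2 * e ^+ 2 + 2 * a * B ^+ 2.
    by rewrite aE; field; lra.
  lra.
have [iw iwK] := gauss_dominated
  (mulr_ge0 (ltW (eqbRL (invr_gt0 _) l10)) (expR_ge0 _)) cE mw wle.
rewrite -KE in iwK.
have qK' y : `|q y| <= l1^-1 * expR (- (2 * (l1 / 2) * enorm (z - y) ^+ 2)).
  by rewrite ger0_norm// (_ : 2 * (l1 / 2) = l1)//; field.
have [iVq _] := @growth_gauss_integral L (l1 / 2) c l1^-1 V q z (ltW L0)
  (divr_gt0 l10 (ltr0Sn _ 1)) (ltW (eqbRL (invr_gt0 _) l10)) cE mV mq VL qK'.
have iq : leb.-integrable setT (EFin \o q).
  apply/integrableP; split; first exact/measurable_EFinP.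
  under eq_integral do rewrite gee0_abs ?lee_fin//.
  by rewrite q1 ltry.
pose M := 2 / a * expR (th ^+ 2 / (2 * a)).
have M0 : 0 <= M by rewrite mulr_ge0 ?expR_ge0// divr_ge0// ltW.
(* Quadratic bound on exp; its linear part integrates to 1. *)
pose r y := (1 - th * g) * q y + th * (V y * q y) + th ^+ 2 * M * w y.
have le_r y : expR (th * (V y - g)) * q y <= r y.
  have h1 := expR_le_quadratic (th * (V y - g)).
  have h2 := sqr_expR_le th (V y - g) a0.
  have h3 : expR (th * (V y - g)) <= 1 + th * (V y - g) +
      th ^+ 2 * (M * expR (a * (V y - g) ^+ 2)).
    apply: (le_trans h1); rewrite lerD2l exprMn -mulrA.
    by rewrite ler_wpM2l ?sqr_ge0.
  apply: (le_trans (ler_wpM2r (q0 y) h3)).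
  by rewrite le_eqVlt; apply/orP; left; apply/eqP; rewrite /r /w; ring.
have i1 : leb.-integrable setT (fun y => ((1 - th * g) * q y)%:E).
  by under eq_fun do rewrite EFinM; exact: integrableZl.
have i2 : leb.-integrable setT (fun y => (th * (V y * q y))%:E).
  by under eq_fun do rewrite EFinM; exact: integrableZl.
have i3 : leb.-integrable setT (fun y => (th ^+ 2 * M * w y)%:E).
  by under eq_fun do rewrite EFinM; exact: integrableZl.
have i12 : leb.-integrable setT
    (fun y => ((1 - th * g) * q y + th * (V y * q y))%:E).
  by under eq_fun do rewrite EFinD; exact: integrableD.
have rE : (\int[leb]_y (r y)%:E = (1 + th ^+ 2 * M * Rintegral leb setT w)%:E)%E.
  have <- : Rintegral leb setT r = 1 + th ^+ 2 * M * Rintegral leb setT w.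
    rewrite /r RintegralD// RintegralD// !RintegralZl// -gE.
    by rewrite [X in _ * X](_ : _ = 1) ?/Rintegral ?q1//=; ring.
  rewrite /Rintegral fineK//; apply: integrable_fin_num => //.
  by under eq_fun do rewrite /r EFinD; exact: integrableD.
apply: (@le_trans _ _ (\int[leb]_y (r y)%:E)%E).
  apply: ge0_le_integral => //.
  - by move=> y _; rewrite lee_fin mulr_ge0 ?expR_ge0.
  - apply/measurable_EFinP; apply: measurable_funM => //; apply: measurableT_comp => //.
    by apply: measurable_funM => //; exact: measurable_funB.
  - apply/measurable_EFinP; do !apply: measurable_funD; do ?apply: measurable_funM => //.
  - by move=> y _; rewrite lee_fin.
rewrite rE lee_fin.
have hK : 1 + th ^+ 2 * M * Rintegral leb setT w <= 1 + th ^+ 2 * M * K.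
  rewrite lerD2l; apply: ler_wpM2l; first by rewrite mulr_ge0// sqr_ge0.
  exact: le_trans (ler_norm _) iwK.
apply: (le_trans hK).
(* With t = th^2 / (2a) and u = 2 th^2 K / a, the bound reached is 1 + e^t u <= e^t (1 + u) <= e^(t
   + u). *)
have -> : (1 / 2 + 2 * K) / a * th ^+ 2 =
  th ^+ 2 / (2 * a) + th ^+ 2 * (2 / a) * K by field; lra.
rewrite expRD /M.
set t := th ^+ 2 / (2 * a).
have t0 : 1 <= expR t.
  rewrite -expR0 ler_expR divr_ge0 ?sqr_ge0//; lra.
have := expR_ge1Dx (th ^+ 2 * (2 / a) * K).
set u := _ * K => hu.
have -> : th ^+ 2 * (2 / a * expR t) * K = expR t * u by rewrite /u; ring.
nra.
Qed.

End gaussian_domination.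

(** * Mean value inequalities from a gradient bound *)

Section mean_value.
Context {R : realType} (d : nat).
Implicit Types (f : 'rV[R]_d -> R) (x v : 'rV[R]_d).

Lemma is_derive_line f x v (t : R) : differentiable f (x + t *: v) ->
  is_derive t 1 (fun t => f (x + t *: v)) ('D_v f (x + t *: v)).
Proof.
move=> df; pose a := x + t *: v.
have quotE : (fun h : R => h^-1 *: ((f (x + (h *: 1 + t) *: v)) - f (x + t *: v)))
           = (fun h : R => h^-1 *: (f (h *: v + a) - f a)).
  apply/funext => h; congr (_ *: (f _ - _)).
  by rewrite /a scalerDl addrCA; congr (_ *: _ + _); rewrite /GRing.scale/= mulr1.
have dv : derivable f a v by exact: diff_derivable.
apply: DeriveDef.
  by rewrite /derivable /= quotE.
by rewrite /derive /= quotE.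
Qed.

Lemma derive_gradient f x v : differentiable f x ->
  `|'D_v f x| <= enorm (gradient f x) * enorm v.
Proof.
move=> df; rewrite deriveE// [in 'd f x v](row_sum_delta v) linear_sum/=.
under eq_bigr => i _ do rewrite linearZ/= -deriveE//.
apply: le_trans (enorm_cauchy_schwarz _ _); rewrite le_eqVlt; apply/orP; left.
by apply/eqP; congr `|_|; apply: eq_bigr => i _; rewrite mxE mulrC.
Qed.

Lemma gradient_mean_value f x z (C : R) :
  (forall y, differentiable f y) ->
  (forall t, 0 <= t <= 1 -> enorm (gradient f (x + t *: (z - x))) <= C) ->
  `|f z - f x| <= C * enorm (z - x).
Proof.
move=> df fC; pose v := z - x.
have [|||t] := @MVT_segment R (fun t => f (x + t *: v)) (fun t => 'D_v f (x + t *: v)) 0 1.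
- by [].
- by move=> t _; exact: is_derive_line.
- apply: derivable_within_continuous => t _.
  by have [] := @is_derive_line f x v t (df _).
rewrite in_itv/= => t01; rewrite scale0r addr0 scale1r subr0 mulr1.
rewrite (_ : x + v = z) => [->|]; last by rewrite /v addrC subrK.
apply: (le_trans (derive_gradient _ (df _))).
by apply: ler_wpM2r; [exact: enorm_ge0|exact: fC].
Qed.

(* For u in [x, z], |u - y|^2 >= |x - y|^2 / 2 - |z - x|^2. *)
Lemma gaussian_mean_value f x y z (l : R) : 0 < l -> enorm (z - x) <= 1 ->
  (forall u, differentiable f u /\
    enorm (gradient f u) <= l^-1 * expR (- (l * enorm (u - y) ^+ 2))) ->
  `|f z - f x| <= enorm (z - x) *
    (l^-1 * expR l * expR (- (l / 2 * enorm (x - y) ^+ 2))).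
Proof.
move=> l0 zx1 fl; rewrite mulrC.
apply: gradient_mean_value => [u|t /andP[t0 t1]]; first by have [] := fl u.
apply: (le_trans (fl _).2); rewrite -mulrA ler_wpM2l ?invr_ge0 ?(ltW l0)//.
rewrite -expRD ler_expR.
set u := x + _ - y; have u0 : 0 <= enorm u by exact: enorm_ge0.
have : enorm (x - y) <= enorm u + 1.
  rewrite (_ : x - y = u - t *: (z - x)); last by rewrite /u addrAC addrK.
  apply: (le_trans (enormD _ _)); rewrite lerD2l enormN enormZ ger0_norm//.
  have := enorm_ge0 (z - x); nra.
move=> h; have : enorm (x - y) ^+ 2 <= 2 * enorm u ^+ 2 + 2.
  apply: (@le_trans _ _ ((enorm u + 1) ^+ 2)).
    by rewrite lerXn2r ?nnegrE ?enorm_ge0// addr_ge0.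
  have : 0 <= (enorm u - 1) ^+ 2 by exact: sqr_ge0.
  nra.
nra.
Qed.

End mean_value.

(** * Truncation and Chernoff's inequality *)

Section truncation.
Context {R : realType}.

Lemma trunc_le (a c : R) : 0 <= c -> `|Num.sg a * Num.min `|a| c| <= c.
Proof.
move=> c0; rewrite normrM normr_sg.
have m0 : 0 <= Num.min `|a| c by rewrite le_min normr_ge0.
rewrite ger0_norm//; have [_|_] := eqVneq a 0; rewrite ?mul0r// mul1r.
by rewrite ge_min lexx orbT.
Qed.

(** Truncation is the projection onto the interval [-c, c], which contains [g], so it cannot
    increase the distance to [g]. *)
Lemma trunc_dist (a c g : R) : `|g| <= c -> `|Num.sg a * Num.min `|a| c - g| <= `|a - g|.
Proof.
rewrite ler_norml => /andP[cg gc].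
have [a0|a0|->] := ltgtP a 0; last by rewrite sgr0 mul0r.
- rewrite ltr0_sg// (ltr0_norm a0) mulN1r; have [_|h] := leP (- a) c; first by rewrite opprK.
  rewrite [leRHS]ler0_norm; last lra.
  rewrite ler_norml; apply/andP; split; lra.
- rewrite gtr0_sg// (gtr0_norm a0) mul1r; have [_|h] := leP a c; first by [].
  rewrite [leRHS]ger0_norm; last lra.
  rewrite ler_norml; apply/andP; split; lra.
Qed.

(** A maximum is 1-Lipschitz for the sup norm. The form with a witness [j] is what a union bound
    over the modes consumes. *)
Lemma best_switch_dist (d D N : nat) (T : R) (f : 'I_D -> R -> 'rV[R]_d -> R)
    (c : 'I_D -> 'I_D -> R -> 'rV[R]_d -> R) n (G G' : 'I_D -> R) i z (delta : R) :
  delta <= `|best_switch N T f c n G i z - best_switch N T f c n G' i z| ->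
  exists j, delta <= `|G j - G' j|.
Proof.
move=> h; apply: contrapT => /forallNP GG'.
have {}GG' j : `|G j - G' j| < delta by rewrite ltNge; apply/negP/GG'.
have H (G1 G2 : 'I_D -> R) : (forall j, `|G1 j - G2 j| < delta) ->
    best_switch N T f c n G1 i z - best_switch N T f c n G2 i z < delta.
  move=> G12; rewrite ltrBlDr /best_switch.
  have le_max j : T / N%:R * f j (grid T N n) z - c i j (grid T N n) z + G1 j <
     delta + \big[Num.max/T / N%:R * f i (grid T N n) z - c i i (grid T N n) z + G2 i]_(j < D)
      (T / N%:R * f j (grid T N n) z - c i j (grid T N n) z + G2 j).
    have := le_bigmax (T / N%:R * f i (grid T N n) z - c i i (grid T N n) z + G2 i)
      (fun j => T / N%:R * f j (grid T N n) z - c i j (grid T N n) z + G2 j) j.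
    have := G12 j; rewrite ltr_norml => /andP[_]; lra.
  by apply/bigmax_ltP.
have h1 := H G G' GG'.
have h2 : best_switch N T f c n G' i z - best_switch N T f c n G i z < delta.
  by apply: H => j; rewrite distrC.
by move: h; rewrite leNgt ltr_norml h1 andbT ltrNl opprB h2.
Qed.

End truncation.

Section chernoff.
Local Open Scope ereal_scope.
Context (R : realType) dO (Omega : measurableType dO) (P : probability Omega R).

Lemma markov_bound (f : Omega -> R) (C : set Omega) (a b : R) :
  measurable_fun setT f -> (forall w, 0 <= f w)%R -> measurable C -> (0 < a)%R ->
  \int[P]_w (f w)%:E <= b%:E -> (forall w, C w -> a <= f w)%R ->
  P C <= (b / a)%:E.
Proof.
move=> mf f0 mC a0 fb Ca.
have h : a%:E * P C <= b%:E.
  apply: le_trans fb; rewrite -(setIT C) -integral_indic// -ge0_integralZl//; last 2 first.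
  - by apply/measurable_EFinP; exact: measurable_indic.
  - by rewrite lee_fin ltW.
  apply: ge0_le_integral => //.
  - by move=> w _; rewrite mule_ge0 ?lee_fin// ltW.
  - by apply: measurable_funeM; apply/measurable_EFinP; exact: measurable_indic.
  - exact/measurable_EFinP.
  - move=> w _; rewrite -EFinM lee_fin indicE.
    by case: (boolP (w \in C)) => [/set_mem /Ca|_]; rewrite ?mulr1// mulr0.
have /fineK PC : P C \is a fin_num by exact: fin_num_measure.
by move: h; rewrite -PC -EFinM !lee_fin ler_pdivlMr// mulrC.
Qed.

(** Expanding the product over subsets [J] turns each term into the probability of an intersection,
    so independence is applied directly in its form for events. *)
Lemma integral_prod_indic (K : finType) (A : K -> set Omega) (c p : R) :
  (0 <= c)%R -> (forall s, measurable (A s)) -> (forall s, P (A s) = p%:E) ->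
  (forall J : {set K}, P (\bigcap_(s in [set` J]) A s) = \prod_(s in J) P (A s)) ->
  \int[P]_w (\prod_s (1 + c * \1_(A s) w))%:E = ((1 + p * c) ^+ #|K|)%:E.
Proof.
move=> c0 mA Ap indA.
have prodE (J : {set K}) w : (\prod_s (if s \in J then c * \1_(A s) w else 1))%R =
    (c ^+ #|J| * \1_(\bigcap_(s in [set` J]) A s) w)%R.
  rewrite -big_mkcond/= big_split/= prodr_const; congr (_ * _)%R.
  rewrite indicE; case: (boolP (w \in _)) => [/set_mem h|/negP h].
    by rewrite big1// => s sJ; rewrite indicE mem_set//; exact: h.
  have [s /= [sJ nA]] : exists s, s \in J /\ ~ A s w.
    apply: contrapT => /forallNP h'; apply: h; apply/mem_set => s /= sJ.
    by apply: contrapT => nA; apply: (h' s).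
  by rewrite (bigD1 s)//= indicE memNset// mul0r.
under eq_integral => w _.
  under eq_bigr do rewrite addrC.
  rewrite bigA_distr -sumEFin.
  under eq_bigr => J _ do rewrite prodE.
  over.
have mcap (J : {set K}) : measurable (\bigcap_(s in [set` J]) A s).
  by apply: fin_bigcap_measurable => // s _.
rewrite ge0_integral_sum//; last 2 first.
- by move=> J; apply/measurable_EFinP/measurable_funM => //; exact: measurable_indic.
- by move=> J w _; rewrite lee_fin mulr_ge0// exprn_ge0.
transitivity (\sum_(J : {set K}) (\prod_s (if s \in J then p * c else 1))%:E)%R.
  apply: eq_bigr => J _.
  under eq_integral do rewrite EFinM.
  rewrite ge0_integralZl//; last 2 first.
  - by apply/measurable_EFinP; exact: measurable_indic.
  - by rewrite lee_fin exprn_ge0.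
  rewrite integral_indic// setIT [X in _ * X](indA J).
  rewrite (eq_bigr (fun=> p%:E)) => [|s _]; last exact: Ap.
  rewrite prodEFin prodr_const -big_mkcond/= prodr_const -EFinM.
  by rewrite exprMn mulrC.
rewrite sumEFin; congr EFin.
rewrite -bigA_distr.
by rewrite prodr_const addrC.
Qed.

(** The exponential parameter is [t = (M - k) / M - p] itself: since M - k = M (t + p), the exponent
    M (t p + t^2 / 2) - t (M - k) equals - M t^2 / 2. For t <= 0 the bound is 1. *)
Lemma chernoff_count (K : finType) (A : K -> set Omega) (k : nat) (p : R) :
  (0 < k <= #|K|)%N ->
  (forall s, measurable (A s)) -> (forall s, P (A s) = p%:E) ->
  (forall J : {set K}, P (\bigcap_(s in [set` J]) A s) = \prod_(s in J) P (A s)) ->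
  forall C, measurable C ->
  (forall w, C w -> (#|K| - k <= #|[set s | w \in A s]%SET|)%N) ->
  P C <= (expR (- (#|K|%:R *
    Num.max ((#|K|%:R - k%:R) / #|K|%:R - p) 0 ^+ 2 / 2)))%:E.
Proof.
move=> /andP[k0 kK] mA Ap indA C mC CA.
set M := #|K|; set t := (_ - p)%R.
have [t0|t0] := leP t 0%R.
  by rewrite expr0n/= mulr0 mul0r oppr0 expR0 probability_le1.
have M0 : (0 < M%:R :> R)%R by rewrite ltr0n (leq_trans k0 kK).
have [s0 _] : exists s0 : K, true by move: k0 kK; rewrite -/M => k0 kM;
  have /card_gt0P[s0 _] : (0 < #|K|)%N by exact: leq_trans kM; exists s0.
have p0 : (0 <= p)%R by rewrite -lee_fin -(Ap s0).
have p1 : (p <= 1)%R by rewrite -lee_fin -(Ap s0) probability_le1.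
have t1 : (t <= 1)%R.
  rewrite /t; apply: (@le_trans _ _ (M%:R / M%:R - 0)%R).
    by apply: lerB => //; rewrite ler_wpM2r ?invr_ge0 ?gerBl ?ler0n// ltW.
  by rewrite divff ?lt0r_neq0// subr0.
(* Chosen so that [1 + c * \1_A = expR (t * \1_A)]; the product [F] is then the exponential of [t]
   times the count. *)
pose c := (expR t - 1)%R.
have c0 : (0 <= c)%R by rewrite subr_ge0 -expR0 ler_expR ltW.
pose F w := (\prod_s (1 + c * \1_(A s) w))%R.
have FE w : F w = expR (t * #|[set s | w \in A s]%SET|%:R).
  rewrite /F expRM_natr -prodr_const [RHS]big_mkcond/=.
  apply: eq_bigr => s _; rewrite indicE inE /c.
  by case: (w \in A s); rewrite ?mulr1 ?mulr0 ?addr0// addrC subrK.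
have h := integral_prod_indic c0 mA Ap indA.
have mF : measurable_fun setT F.
  apply: measurable_prod => s _; apply: measurable_funD => //.
  by apply: measurable_funM => //; exact: measurable_indic.
have := @markov_bound F C (expR (t * (M - k)%:R)) ((1 + p * c) ^+ M) mF _ mC _ _ _.
move=> /(_ _ _ _ _)/le_trans; apply.
- by move=> w; rewrite FE expR_ge0.
- exact: expR_gt0.
- by rewrite h.
- by move=> w /CA Cw; rewrite FE ler_expR ler_wpM2l ?ler_nat// ltW.
rewrite lee_fin ler_pdivrMr ?expR_gt0// -expRD.
have p01 : (0 <= p <= 1)%R by rewrite p0 p1.
have t01 : (0 <= t <= 1)%R by rewrite ltW.
have hb := bernoulli_mgf p01 t01.
have pc0 : (0 <= 1 + p * c)%R by rewrite addr_ge0// mulr_ge0.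
apply: (@le_trans _ _ (expR (t * p + t ^+ 2 / 2) ^+ M)%R).
  by rewrite lerXn2r ?nnegrE// expR_ge0.
rewrite -expRM_natr ler_expR natrB// le_eqVlt; apply/orP; left; apply/eqP.
have tE : (M%:R - k%:R = M%:R * (t + p))%R by rewrite /t subrK mulrCA divff ?mulr1// lt0r_neq0.
by rewrite tE; field.
Qed.
End chernoff.

(** * The estimators *)

Section measurable_estimators.
Context {R : realType}.

Lemma measurable_sgr : measurable_fun setT (@Num.sg R).
Proof.
have -> : @Num.sg R = fun x => if x < 0 then -1 else if 0 < x then 1 else 0.
  by apply/funext => x; case: ltgtP => [/ltr0_sg|/gtr0_sg|->] //; exact: sgr0.
apply: measurable_fun_ifT => //; first exact: measurable_fun_ltr.
by apply: measurable_fun_ifT => //; exact: measurable_fun_ltr.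
Qed.

(** Tonelli applies to the positive and negative parts separately, and [fine] keeps the difference
    measurable even where the integral diverges. *)
Lemma measurable_Rintegral_param d1 d2 (Q : measurableType d1) (E : measurableType d2)
    (mu : {sigma_finite_measure set E -> \bar R}) (H : Q -> E -> R) :
  measurable_fun setT (fun p : Q * E => H p.1 p.2) ->
  measurable_fun setT (fun q => Rintegral mu setT (H q)).
Proof.
move=> mH; have mHE : measurable_fun setT (fun p : Q * E => (H p.1 p.2)%:E).
  exact/measurable_EFinP.
have mp := @measurable_fun_fubini_tonelli_F _ _ _ _ _ mu _ (measurable_funepos mHE)
  (fun p => funepos_ge0 _ p).
have mn := @measurable_fun_fubini_tonelli_F _ _ _ _ _ mu _ (measurable_funeneg mHE)
  (fun p => funeneg_ge0 _ p).
apply: (measurableT_comp (@fine_measurable R setT measurableT)).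
under eq_fun do rewrite integralE.
apply: emeasurable_funB.
- by apply: eq_measurable_fun mp => q _; apply: eq_integral => y _; rewrite !funeposE.
- by apply: eq_measurable_fun mn => q _; apply: eq_integral => y _; rewrite !funenegE.
Qed.

Lemma measurable_bigmaxr d1 (Q : measurableType d1) (K : Type) (s : seq K)
    (F0 : Q -> R) (F : K -> Q -> R) :
  measurable_fun setT F0 -> (forall j, measurable_fun setT (F j)) ->
  measurable_fun setT (fun q => \big[Num.max/F0 q]_(j <- s) F j q).
Proof.
move=> mF0 mF; elim: s => [|j s IH].
  by under eq_fun do rewrite big_nil.
by under eq_fun do rewrite big_cons; exact: measurable_maxr.
Qed.

Lemma grid_itv (T : R) (N n : nat) : 0 < T -> (n < N)%N -> 0 <= grid T N n <= T.
Proof.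
move=> T0 nN; have N0 : 0 < N%:R :> R by rewrite ltr0n (leq_ltn_trans _ nN).
rewrite /grid mulrCA; apply/andP; split.
  by rewrite mulr_ge0 ?(ltW T0)// divr_ge0.
by rewrite ler_piMr ?(ltW T0)// ler_pdivrMr// mul1r ler_nat ltnW.
Qed.

Context (d D M mY N k : nat) (T : R).
Variables (f : 'I_D -> R -> 'rV[R]_d -> R).
Variables (c : 'I_D -> 'I_D -> R -> 'rV[R]_d -> R).
Variables (trunc : nat -> R).
Variable nn : nat -> M.-tuple 'rV[R]_d -> 'rV[R]_d -> {set 'I_M}.
Hypothesis T_gt0 : 0 < T.
Hypothesis mf : forall j s, 0 <= s <= T -> measurable_fun setT (f j s).
Hypothesis mc : forall i j s, 0 <= s <= T -> measurable_fun setT (c i j s).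
Hypothesis nnP : forall l, (l < N)%N -> nearest_neighbour_rule k (nn l).

Context d1 (Q : measurableType d1).
Variables (xs : 'I_M -> nat -> Q -> 'rV[R]_d).
Variables (xt : nat -> 'I_M -> 'I_mY -> Q -> 'rV[R]_d).

Lemma measurable_best_switch n i (G : 'I_D -> Q -> R) (z : Q -> 'rV[R]_d) :
  (n < N)%N -> (forall j, measurable_fun setT (G j)) -> measurable_fun setT z ->
  measurable_fun setT (fun q => best_switch N T f c n (fun j => G j q) i (z q)).
Proof.
move=> nN mG mz; have tT := grid_itv T_gt0 nN.
have mF j : measurable_fun setT (fun q =>
    T / N%:R * f j (grid T N n) (z q) - c i j (grid T N n) (z q) + G j q).
  apply: measurable_funD => //; apply: measurable_funB.
    by apply: measurable_funM => //; exact: measurableT_comp (mf j tT) mz.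
  exact: measurableT_comp (mc i j tT) mz.
exact: measurable_bigmaxr.
Qed.

(** The rule takes finitely many values, so the event is a finite union of sets on which the rule is
    constant. *)
Lemma measurable_neighbours n (z : Q -> 'rV[R]_d) (B : pred {set 'I_M}) :
  (n < N)%N -> (forall s, measurable_fun setT (xs s n)) -> measurable_fun setT z ->
  measurable_fun setT (fun q => B (nn n [tuple xs s n q | s < M] (z q))).
Proof.
move=> nN mxs mz; apply: (measurable_fun_bool true); rewrite setTI.
have mp : measurable_fun setT (fun q => ([tuple xs s n q | s < M], z q)).
  apply: measurable_fun_pair => //; apply/measurable_fun_tnthP => s.
  by rewrite (_ : _ \o _ = xs s n)//; apply/funext => q /=; rewrite tnth_mktuple.
rewrite (_ : _ @^-1` _ = \bigcup_(S in [set` B])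
    ((fun q => ([tuple xs s n q | s < M], z q)) @^-1` [set q | nn n q.1 q.2 = S])).
  apply: fin_bigcup_measurable => // S _.
  by rewrite -[X in measurable X]setTI; apply: mp => //; exact: (nnP nN).2.
apply/seteqP; split => q /=; first by move=> h; exists (nn n [tuple xs s n q | s < M] (z q)).
by move=> [S BS E]; rewrite E.
Qed.

Lemma measurable_neighbour_sum n (z : Q -> 'rV[R]_d) (G : 'I_M -> Q -> R) :
  (n < N)%N -> (forall s, measurable_fun setT (xs s n)) -> measurable_fun setT z ->
  (forall s, measurable_fun setT (G s)) ->
  measurable_fun setT (fun q =>
    \sum_(s in nn n [tuple xs s n q | s < M] (z q)) G s q).
Proof.
move=> nN mxs mz mG; under eq_fun do rewrite big_mkcond/=.
apply: measurable_sum => s; apply: measurable_fun_ifT => //.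
exact: (@measurable_neighbours _ _ (fun S : {set 'I_M} => s \in S)).
Qed.

(** Measurability is asked only of the data at times from N - m on. This tracks which transitions
    the value function depends on, and [Q] is left arbitrary so that it may be an [exceptType]. The
    point [z] varies with [q] because the value is evaluated at sampled points. *)
Lemma measurable_V_back m i (z : Q -> 'rV[R]_d) : (m <= N)%N ->
  (forall s l, (N - m <= l < N)%N -> measurable_fun setT (xs s l)) ->
  (forall l s h, (N - m <= l < N)%N -> measurable_fun setT (xt l s h)) ->
  measurable_fun setT z ->
  measurable_fun setT (fun q => V_back N k T f c trunc nn
    (fun s l => xs s l q) (fun l s h => xt l s h q) m i (z q)).
Proof.
elim: m i z => [|m IH] i z mN mxs mxt mz /=; first exact: measurable_cst.
have nN : (N - m.+1 < N)%N by rewrite ltn_subrL (leq_trans _ mN).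
have IH' j z' : measurable_fun setT z' -> measurable_fun setT (fun q =>
    V_back N k T f c trunc nn (fun s l => xs s l q) (fun l s h => xt l s h q) m j (z' q)).
  apply: IH; first exact: ltnW.
  - move=> s l /andP[h1 h2]; apply: mxs; rewrite h2 andbT.
    by apply: leq_trans h1; rewrite leq_sub2l.
  - move=> l s h /andP[h1 h2]; apply: mxt; rewrite h2 andbT.
    by apply: leq_trans h1; rewrite leq_sub2l.
have mn : (N - m.+1 <= N - m.+1 < N)%N by rewrite leqnn.
apply: (@measurable_best_switch _ _ (fun j q => g_hat k trunc nn
  (fun s l => xs s l q) (fun l s h => xt l s h q) (N - m.+1)
  (V_back N k T f c trunc nn (fun s l => xs s l q) (fun l s h => xt l s h q) m j) (z q))) => // j.
have mg : measurable_fun setT (fun q => g_tilde k nn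
  (fun s l => xs s l q) (fun l s h => xt l s h q) (N - m.+1)
  (V_back N k T f c trunc nn (fun s l => xs s l q) (fun l s h => xt l s h q) m j) (z q)).
  apply: measurable_funM => //; apply: measurable_neighbour_sum => //.
  - by move=> s; exact: mxs.
  - by move=> s; apply: measurable_sum => h; apply: IH'; exact: mxt.
apply: measurable_funM; first exact: measurableT_comp measurable_sgr mg.
apply: measurable_minr; first exact: measurableT_comp mg.
apply: measurable_funM => //; apply: measurable_funD => //.
exact: measurableT_comp (@measurable_enorm R d) mz.
Qed.

Lemma measurable_V_hat l i (z : Q -> 'rV[R]_d) :
  (forall s l', (l <= l' < N)%N -> measurable_fun setT (xs s l')) ->
  (forall l' s h, (l <= l' < N)%N -> measurable_fun setT (xt l' s h)) ->
  measurable_fun setT z ->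
  measurable_fun setT (fun q => V_hat N k T f c trunc nn
    (fun s l' => xs s l' q) (fun l' s h => xt l' s h q) l i (z q)).
Proof.
move=> mxs mxt; have le l' : (N - (N - l) <= l' < N)%N -> (l <= l' < N)%N.
  by move=> /andP[h1 h2]; rewrite h2 andbT; move: h1 h2; lia.
apply: measurable_V_back; first exact: leq_subr.
- by move=> s l' /le; exact: mxs.
- by move=> l' s h /le; exact: mxt.
Qed.

End measurable_estimators.

(** * Integrating out the conditionally independent samples *)

Section peeling.
Local Open Scope ereal_scope.
Context (R : realType) dO (Omega : measurableType dO) (P : probability Omega R).
Context d (E : measurableType d) (leb : {sigma_finite_measure set E -> \bar R}).
Context (K : finType) (Y : K -> Omega -> E) (GG : set (set Omega)).
Hypothesis GGm : <<s GG >> `<=` measurable.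
Hypothesis mY : forall i, measurable_fun setT (Y i).
Hypothesis indep : cond_mutually_independent P <<s GG >> Y.
Variable q : K -> Omega -> E -> R.
Hypothesis mq : forall i, measurable_fun setT (fun p : Omega * E => q i p.1 p.2).
Hypothesis q0 : forall i w y, (0 <= q i w y)%R.
Hypothesis q1 : forall i w, \int[leb]_y (q i w y)%:E = 1.
Hypothesis Yq : forall i A, measurable A ->
  cond_prob P <<s GG >> (Y i @^-1` A) (fun w => Rintegral leb A (q i w)).

Variables (A : Omega -> R) (Phi : K -> Omega -> E -> R).
Hypothesis A0 : forall w, (0 <= A w)%R.
Hypothesis Phi0 : forall i w y, (0 <= Phi i w y)%R.

(** The weight and the factors of the tail do not involve [Y i], so [freezing] replaces the head
    factor by its integral against [q i], at most 1. That bound is asked only where the weight [A]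
    is positive, so an indicator as weight restricts it to a favourable event. *)
Lemma peeling (l : seq K) : uniq l ->
  (forall i, i \in l ->
    measurable_fun setT (fun p : exceptType Y GG i => A p.1)) ->
  (forall i j, i \in l -> j \in l -> j != i ->
    measurable_fun setT (fun p : exceptType Y GG i => Phi j p.1 (Y j p.1))) ->
  (forall i, i \in l ->
    measurable_fun setT (fun p : exceptType Y GG i => Phi i p.1 p.2)) ->
  (forall i, i \in l -> {ae P, forall w, (0 < A w)%R ->
    \int[leb]_y (q i w y * Phi i w y)%:E <= 1}) ->
  \int[P]_w (A w * \prod_(i <- l) Phi i w (Y i w))%:E <= \int[P]_w (A w)%:E.
Proof.
elim: l => [_ _ _ _ _|i l IH /andP[il ul] mA mPhi mPhi1 Phi_le1].
  by under eq_integral do rewrite big_nil mulr1.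
have inl j : j \in l -> j \in i :: l by move=> jl; rewrite inE jl orbT.
have il' : i \in i :: l by rewrite inE eqxx.
pose B w := (A w * \prod_(j <- l) Phi j w (Y j w))%R.
have B0 w : (0 <= B w)%R by rewrite mulr_ge0// prodr_ge0.
have mB : measurable_fun setT (fun p : exceptType Y GG i => B p.1).
  apply: measurable_funM; first exact: mA.
  apply: measurable_prod => j jl; apply: mPhi => //; first exact: inl.
  by apply: contraNneq il => <-.
pose F (p : Omega * E) := (B p.1 * Phi i p.1 p.2)%:E.
have mF : measurable_fun setT (F : exceptType Y GG i -> \bar R).
  by apply/measurable_EFinP; apply: measurable_funM => //; exact: mPhi1.
have F0 p : 0 <= F p by rewrite lee_fin mulr_ge0.
have mi : measurable_fun setT (fun p : Omega * E => p : exceptType Y GG i).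
  have := measurable_to_except (i0 := i) GGm mY measurable_fst measurable_snd.
  by apply: eq_measurable_fun => -[].
have mBO : measurable_fun setT B.
  have := measurableT_comp mB (measurable_to_except (i0 := i) GGm mY
    (@measurable_id _ Omega setT) (mY i)).
  by [].
have mqPhi : measurable_fun setT (fun p : Omega * E => (q i p.1 p.2 * Phi i p.1 p.2)%:E).
  apply/measurable_EFinP; apply: measurable_funM => //.
  exact: (measurableT_comp (mPhi1 i il') mi).
have cP j A' : measurable A' ->
    exists2 Z, cond_prob P <<s GG >> (Y j @^-1` A') Z & forall w, (0 <= Z w)%R.
  move=> mA'; exists (fun w => Rintegral leb A' (q j w)); first exact: Yq.
  by move=> w; apply: Rintegral_ge0.
apply: (@le_trans _ _ (\int[P]_w (B w)%:E)); last first.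
  apply: IH => //.
  - by move=> j /inl; exact: mA.
  - by move=> j j' /inl jl /inl j'l; exact: mPhi.
  - by move=> j /inl; exact: mPhi1.
  - by move=> j /inl; exact: Phi_le1.
have -> : \int[P]_w (A w * \prod_(j <- i :: l) Phi j w (Y j w))%:E =
    \int[P]_w F (w, Y i w).
  apply: eq_integral => w _; rewrite big_cons /F/= /B; congr EFin.
  by rewrite mulrCA mulrC.
rewrite (freezing GGm mY indep cP (mq i) (q0 i) (q1 i) (Yq i) mF F0).
have FE w : \int[leb]_y ((q i w y)%:E * F (w, y)) =
    (B w)%:E * \int[leb]_y (q i w y * Phi i w y)%:E.
  rewrite -ge0_integralZl//; last 3 first.
  - exact: (measurableT_comp mqPhi (pair1_measurable w)).
  - by move=> y _; rewrite lee_fin mulr_ge0.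
  - by rewrite lee_fin.
  by apply: eq_integral => y _; rewrite /F/= -!EFinM mulrCA.
under eq_integral do rewrite FE.
apply: ae_ge0_le_integral => //.
- by move=> w _; rewrite mule_ge0 ?lee_fin//; apply: integral_ge0 => y _;
    rewrite lee_fin mulr_ge0.
- apply: emeasurable_funM; first exact/measurable_EFinP.
  apply: (@measurable_fun_fubini_tonelli_F _ _ _ _ _ leb _ mqPhi) => p.
  by rewrite lee_fin mulr_ge0.
- by move=> w _; rewrite lee_fin.
- exact/measurable_EFinP.
apply: filterS (Phi_le1 i il') => w h _.
have [A00|Aw] := eqVneq (A w) 0%R; first by rewrite /B A00 mul0r mul0e.
rewrite -[leRHS]mule1; apply: lee_wpmul2l; first by rewrite lee_fin.
by apply: h; rewrite lt_def Aw A0.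
Qed.
End peeling.

Lemma union_bound (R : realType) dO (Omega : measurableType dO) (P : probability Omega R)
    (K : finType) (A : K -> set Omega) (b : R) :
  (forall i, measurable (A i)) -> (forall i, (P (A i) <= b%:E)%E) ->
  measurable (\bigcup_(i in [set: K]) A i) /\
  (P (\bigcup_(i in [set: K]) A i) <= (#|K|%:R * b)%:E)%E.
Proof.
move=> mA Ab; split; first exact: fin_bigcup_measurable.
have -> : \bigcup_(i in [set: K]) A i = \big[setU/set0]_(i <- enum K) A i.
  rewrite -bigcup_seq; apply/seteqP; split => w [i _ Aw]; exists i => //=.
  by rewrite mem_enum.
rewrite cardE; elim: (enum K) => [|i s IH].
  by rewrite big_nil measure0 mul0r.
rewrite big_cons; apply: le_trans (measureU2 _ _ _) _ => //.
  exact: bigsetU_measurable.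
by rewrite /= -natr1 mulrDl mul1r addrC EFinD leeD.
Qed.

(** * Deviation of the nearest-neighbour estimator at one point *)

Section nearest_neighbour_regression.
Context {R : realType} (d D M N mY k : nat) (T : R).
Hypotheses (mY_gt0 : (0 < mY)%N) (kM : (0 < k <= M)%N) (T_gt0 : 0 < T).
Variables (f : 'I_D -> R -> 'rV[R]_d -> R).
Variables (c : 'I_D -> 'I_D -> R -> 'rV[R]_d -> R).
Variables (rho : 'rV[R]_d -> R -> 'rV[R]_d -> R -> R).
Hypothesis mf : forall j s, 0 <= s <= T -> measurable_fun setT (f j s).
Hypothesis mc : forall i j s, 0 <= s <= T -> measurable_fun setT (c i j s).
Hypothesis rhoP : transition_density N T rho.
Context (dO : measure_display) (Omega : measurableType dO) (P : probability Omega R).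
Variables (Xs : 'I_M -> nat -> Omega -> 'rV[R]_d).
Variables (Xt : nat -> 'I_M -> 'I_mY -> Omega -> 'rV[R]_d).
Hypothesis mXs : forall s l, (l <= N)%N -> measurable_fun setT (Xs s l).
Hypothesis mXt : forall l s h, (l < N)%N -> measurable_fun setT (Xt l s h).
Hypothesis Xt_samples : one_step_samples P N T rho Xs Xt.
Variables (nn : nat -> M.-tuple 'rV[R]_d -> 'rV[R]_d -> {set 'I_M}) (trunc : nat -> R).
Variable n : nat.
Hypothesis nnP : forall l, (l < N)%N -> nearest_neighbour_rule k (nn l).
Hypothesis nN : (n < N)%N.
Variable x : 'rV[R]_d.

Local Notation leb := (lebesgue_rV d : {sigma_finite_measure set 'rV[R]_d -> \bar R}).

Definition step_density (l : nat) (z y : 'rV[R]_d) : R :=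
  rho z (grid T N l) y (grid T N l + T / N%:R).

Definition next_value j y w : R := V_hat N k T f c trunc nn
  (fun s l => Xs s l w) (fun l s h => Xt l s h w) n.+1 j y.

Definition next_mean j z w : R :=
  Rintegral leb setT (fun y => next_value j y w * step_density n z y).

Definition neighbours w : {set 'I_M} := nn n [tuple Xs s n w | s < M] x.

Definition neighbours_within r w : bool :=
  [forall s in neighbours w, enorm (Xs s n w - x) <= r].

Definition centred_mean j w : R := (k * mY)%:R^-1 *
  \sum_(s in neighbours w) \sum_(h < mY)
    (next_value j (Xt n s h w) w - next_mean j (Xs s n w) w).

Lemma measurable_step_density l z : (l < N)%N -> measurable_fun setT (step_density l z).
Proof.
move=> lN; have [mrho _ _] := rhoP lN.
exact: (measurableT_comp mrho (pair1_measurable z)).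
Qed.

Section measurability.
Context dQ (Q : measurableType dQ) (u : Q -> Omega).
Hypothesis mXsu : forall s l, (l <= N)%N -> measurable_fun setT (fun q => Xs s l (u q)).
Hypothesis mXtu : forall l s h, (n < l < N)%N -> measurable_fun setT (fun q => Xt l s h (u q)).

(** [u] will be the identity of [Omega] or the first projection of an [exceptType]. In the second
    case the transition left out has time [n], and the next value uses transitions later than [n]
    only. *)
Lemma measurable_next_value j (z : Q -> 'rV[R]_d) : measurable_fun setT z ->
  measurable_fun setT (fun q => next_value j (z q) (u q)).
Proof.
move=> mz; apply: (@measurable_V_hat R d D M mY N k T f c trunc nn T_gt0 mf mc nnP _ Q
  (fun s l q => Xs s l (u q)) (fun l s h q => Xt l s h (u q))) => //.
by move=> s l /andP[_ lN]; apply: mXsu; exact: ltnW.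
Qed.

Lemma measurable_neighbours_within r :
  measurable_fun setT (fun q => neighbours_within r (u q)).
Proof.
apply: (measurable_fun_bool true); rewrite setTI.
rewrite (_ : _ @^-1` _ = \bigcap_(s in [set: 'I_M])
    ((fun q => (s \in neighbours (u q)) ==> (enorm (Xs s n (u q) - x) <= r))
      @^-1` [set true])).
  apply: fin_bigcap_measurable => // s _; rewrite -[X in measurable X]setTI.
  have m1 : measurable_fun setT (fun q => s \in neighbours (u q)).
    apply: (@measurable_neighbours R d M N k nn nnP _ Q
      (fun s l q => Xs s l (u q)) n (fun=> x) (fun S : {set 'I_M} => s \in S)) => //.
    by move=> s'; apply: mXsu; exact: ltnW.
  have m2 : measurable_fun setT (fun q => enorm (Xs s n (u q) - x) <= r).
    apply: measurable_fun_ler => //.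
    apply: (measurableT_comp (@measurable_enorm R d)).
    by apply: measurable_funB_mx => //; apply: mXsu; exact: ltnW.
  have -> : (fun q => (s \in neighbours (u q)) ==> (enorm (Xs s n (u q) - x) <= r)) =
     (fun q => if s \in neighbours (u q) then enorm (Xs s n (u q) - x) <= r else true).
    by apply/funext => q; case: (s \in _).
  by apply: measurable_fun_ifT.
apply/seteqP; split => q /=.
  by move=> /forallP h s _; exact: h.
by move=> h; apply/forallP => s; exact: h.
Qed.

End measurability.

Lemma measurable_next_mean dQ (Q : measurableType dQ) (u : Q -> Omega) j (z : Q -> 'rV[R]_d) :
  (forall s l, (l <= N)%N -> measurable_fun setT (fun q => Xs s l (u q))) ->
  (forall l s h, (n < l < N)%N -> measurable_fun setT (fun q => Xt l s h (u q))) ->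
  measurable_fun setT z ->
  measurable_fun setT (fun q => next_mean j (z q) (u q)).
Proof.
move=> mXsu mXtu mz; apply: (@measurable_Rintegral_param _ _ _ _ _ leb
  (fun q y => next_value j y (u q) * step_density n (z q) y)).
apply: measurable_funM.
  apply: (@measurable_next_value _ _ (fun p : Q * 'rV[R]_d => u p.1)) => //.
  - by move=> s l lN; exact: measurableT_comp (mXsu s l lN) measurable_fst.
  - by move=> l s h lN; exact: measurableT_comp (mXtu l s h lN) measurable_fst.
have [mrho _ _] := rhoP nN.
have mzy : measurable_fun setT (fun p : Q * 'rV[R]_d => (z p.1, p.2)).
  apply: measurable_fun_pair => //; exact: measurableT_comp mz measurable_fst.
exact: (measurableT_comp mrho mzy).
Qed.

Lemma measurable_natr_bool dQ (Q : measurableType dQ) (b : Q -> bool) :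
  measurable_fun setT b -> measurable_fun setT (fun q => (b q)%:R : R).
Proof.
move=> mb; rewrite (_ : (fun _ => _) = fun q => if b q then 1 else 0).
  exact: measurable_fun_ifT.
by apply/funext => q; case: (b q).
Qed.

Lemma card_neighbours w : #|neighbours w| = k.
Proof. by have [/(_ [tuple Xs s n w | s < M] x)[]] := nnP nN. Qed.

Let Y (i : 'I_N * 'I_M * 'I_mY) : Omega -> 'rV[R]_d := Xt i.1.1 i.1.2 i.2.

Let trajectory_events : set (set Omega) :=
  \bigcup_(sl in [set sl : 'I_M * nat | (sl.2 <= N)%N])
    preimage_set_system setT (Xs sl.1 sl.2) measurable.

Let trajectory_Xs s l B : (l <= N)%N -> measurable B ->
  <<s trajectory_events >> (Xs s l @^-1` B).
Proof.
move=> lN mB; apply: sub_sigma_algebra; exists (s, l) => //.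
by exists B => //; rewrite setTI.
Qed.

Let trajectory_eventsW : <<s trajectory_events >> `<=` measurable.
Proof.
apply: smallest_sub; first exact: sigma_algebra_measurable.
by move=> _ [[s l] /= lN [B mB <-]]; exact: mXs.
Qed.

Let n0 : 'I_N := Ordinal nN.

Lemma measurable_tail_event j r th a :
  measurable [set w | neighbours_within r w /\ a <= th * centred_mean j w].
Proof.
have mwithin : measurable_fun setT (neighbours_within r).
  exact: (@measurable_neighbours_within _ _ id).
have mXs' s l : (l <= N)%N -> measurable_fun setT (fun w => Xs s l (id w)).
  exact: mXs.
have mXt' l s h : (n < l < N)%N -> measurable_fun setT (fun w => Xt l s h (id w)).
  by move=> /andP[_]; exact: mXt.
have mV s h : measurable_fun setT (fun w => next_value j (Xt n s h w) w).
  by apply: (@measurable_next_value _ _ id) => //; exact: mXt.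
have mg s : measurable_fun setT (fun w => next_mean j (Xs s n w) w).
  by apply: (@measurable_next_mean _ _ id) => //; apply: mXs; exact: ltnW.
have mcentred : measurable_fun setT (centred_mean j).
  apply: measurable_funM => //.
  apply: (@measurable_neighbour_sum R d M N k nn nnP _ _ (fun s l w => Xs s l w) n (fun=> x)) => //.
  - by move=> s; apply: mXs; exact: ltnW.
  - by move=> s; apply: measurable_sum => h; exact: measurable_funB.
apply: measurableI; first by have := mwithin measurableT [set true] I; rewrite setTI.
rewrite -[X in measurable X]setTI; apply: measurable_fun_le => //.
exact: measurable_funM.
Qed.

Section exponential_moment.
Variables (j : 'I_D) (kappa r th : R).
Hypothesis r1 : r <= 1.
Hypothesis subg : {ae P, forall w, forall z, enorm (z - x) <= 1 ->
  (\int[leb]_y (expR (th * (next_value j y w - next_mean j z w)) * step_density n z y)%:E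
   <= (expR (kappa * th ^+ 2))%:E)%E}.

(** Subtracting [kappa * th ^+ 2] normalises the factor to conditional mean at most 1, and the value
    1 away from the neighbours turns a product over a random set into one over the fixed list
    [idx]. *)
Let Phi (i : 'I_N * 'I_M * 'I_mY) (w : Omega) (y : 'rV[R]_d) : R :=
  if i.1.2 \in neighbours w then
    expR (th * (next_value j y w - next_mean j (Xs i.1.2 n w) w) - kappa * th ^+ 2)
  else 1.

Let idx : seq ('I_N * 'I_M * 'I_mY) :=
  [seq (n0, p.1, p.2) | p <- enum {: 'I_M * 'I_mY}].

Let measurable_Phi dQ (Q : measurableType dQ) (u : Q -> Omega) (z : Q -> 'rV[R]_d) i :
  (forall s l, (l <= N)%N -> measurable_fun setT (fun q => Xs s l (u q))) ->
  (forall l s h, (n < l < N)%N -> measurable_fun setT (fun q => Xt l s h (u q))) ->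
  measurable_fun setT z ->
  measurable_fun setT (fun q => Phi i (u q) (z q)).
Proof.
move=> mXsu mXtu mz; apply: measurable_fun_ifT => //.
  apply: (@measurable_neighbours R d M N k nn nnP _ Q
    (fun s l q => Xs s l (u q)) n (fun=> x) (fun S : {set 'I_M} => i.1.2 \in S)) => //.
  by move=> s; apply: mXsu; exact: ltnW.
apply: measurableT_comp => //; apply: measurable_funB => //.
apply: measurable_funM => //; apply: measurable_funB.
  exact: measurable_next_value.
by apply: measurable_next_mean => //; apply: mXsu; exact: ltnW.
Qed.

Lemma exponential_moment_le1 :
  (\int[P]_w ((neighbours_within r w)%:R * \prod_(i <- idx) Phi i w (Y i w))%:E <= 1)%E.
Proof.
have mw : measurable_fun setT (fun w => (neighbours_within r w)%:R : R).
  by apply: measurable_natr_bool; apply: (@measurable_neighbours_within _ _ id).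
apply: (@le_trans _ _ (\int[P]_w ((neighbours_within r w)%:R)%:E)%E); last first.
  apply: (@le_trans _ _ (\int[P]_w (cst 1 w))%E).
    apply: ge0_le_integral => //; first exact/measurable_EFinP.
    by move=> w _; rewrite /= lee_fin; case: neighbours_within.
  by rewrite integral_cst// mul1e (probability_le1 P measurableT).
have mXse i s l : (l <= N)%N ->
    measurable_fun setT (fun p : exceptType Y trajectory_events i => Xs s l p.1).
  by move=> lN; apply: measurable_except_gen => B; exact: trajectory_Xs.
have mXte i l s h : i \in idx -> (n < l < N)%N ->
    measurable_fun setT (fun p : exceptType Y trajectory_events i => Xt l s h p.1).
  move=> /mapP[p _ ->] /andP[nl lN].
  apply: (@measurable_except_neq _ _ _ _ _ Y _ _ (Ordinal lN, s, h)).
  by apply/eqP => -[/eqP]; rewrite gtn_eqF.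
apply: (@peeling R dO Omega P _ _ leb _ Y trajectory_events trajectory_eventsW _ _
  (fun i w y => step_density i.1.1 (Xs i.1.2 i.1.1 w) y)) => //.
- by move=> i; exact: mXt.
- exact: Xt_samples.1.
- move=> i; have [mrho _ _] := rhoP (ltn_ord i.1.1).
  have mp : measurable_fun setT (fun p : Omega * 'rV[R]_d => (Xs i.1.2 i.1.1 p.1, p.2)).
    apply: measurable_fun_pair => //.
    by apply: measurableT_comp measurable_fst; apply: mXs; exact: ltnW.
  exact: (measurableT_comp mrho mp).
- by move=> i w y; have [_ + _] := rhoP (ltn_ord i.1.1); exact.
- by move=> i w; have [_ _] := rhoP (ltn_ord i.1.1); exact.
- by move=> i A mA; apply: Xt_samples.2.
- by move=> i w y; rewrite /Phi; case: ifP => // _; exact: expR_ge0.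
- rewrite map_inj_uniq ?enum_uniq// => -[s h] [s' h'] /= [].
  by move=> -> ->.
- move=> i il; apply: measurable_natr_bool.
  apply: (@measurable_neighbours_within _ _ (fun p : exceptType Y trajectory_events i => p.1)).
  exact: mXse.
- move=> i i' il i'l ii'; apply: measurable_Phi.
  + exact: mXse.
  + by move=> l s h; exact: mXte.
  + exact: measurable_except_neq.
- move=> i il; apply: measurable_Phi.
  + exact: mXse.
  + by move=> l s h; exact: mXte.
  + exact: measurable_except_snd.
(* A positive weight means that every neighbour is within [r <= 1] of [x], which is where [subg]
   applies; a sample that is not a neighbour contributes the total mass 1 of the density. *)
- move=> _ /mapP[[s h] _ ->]/=; apply: filterS subg => w gw.
  rewrite /neighbours_within; case: forallP => [/(_ s) /= sw _|]; last by rewrite ltxx.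
  have [_ q0 q1] := rhoP nN.
  have [sn|/negbTE sn] := boolP (s \in neighbours w); last first.
    by under eq_integral do rewrite /Phi/= sn mulr1; rewrite q1.
  rewrite sn /= in sw.
  under eq_integral => y _.
    rewrite /Phi/= sn expRD mulrA [step_density _ _ _ * _]mulrC EFinM; over.
  rewrite ge0_integralZr//; last 2 first.
  + apply/measurable_EFinP; apply: measurable_funM; last exact: measurable_step_density.
    apply: measurableT_comp => //; apply: measurable_funM => //.
    apply: measurable_funB => //.
    exact: (@measurable_next_value _ _ (fun=> w)).
  + by move=> y _; rewrite lee_fin mulr_ge0 ?expR_ge0//; exact: q0.
  apply: (@le_trans _ _ ((expR (kappa * th ^+ 2))%:E * (expR (- (kappa * th ^+ 2)))%:E)%E).
    by apply: lee_wpmul2r; [rewrite lee_fin expR_ge0|apply: gw; exact: le_trans sw r1].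
  by rewrite -EFinM -expRD subrr expR0.
Qed.

(** On the event, the product of the factors is the exponential of k mY (th * centred_mean - kappa
    th^2), so Markov's inequality applies. The sign of [th] is free, so both tails are covered. *)
Lemma centred_mean_tail a :
  (P [set w | neighbours_within r w /\ (a <= th * centred_mean j w)%R] <=
   (expR (- ((k * mY)%:R * (a - kappa * th ^+ 2))))%:E)%E.
Proof.
have kmY0 : (0 : R) < (k * mY)%:R by rewrite ltr0n muln_gt0 mY_gt0; case/andP: kM => ->.
rewrite expRN -[X in X%:E]mul1r.
apply: (markov_bound _ _ (measurable_tail_event _ _ _ _) _ exponential_moment_le1).
- apply: measurable_funM; first exact/measurable_natr_bool/(@measurable_neighbours_within _ _ id).
  apply: measurable_prod => i /mapP[p _ ->].
  apply: (@measurable_Phi _ _ id); [exact: mXs| |exact: mXt].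
  by move=> l s h /andP[_]; exact: mXt.
- move=> w; rewrite mulr_ge0//; apply: prodr_ge0 => i _.
  by rewrite /Phi; case: ifP => // _; exact: expR_ge0.
- exact: expR_gt0.
- move=> w [-> aw]; rewrite mul1r.
  rewrite big_map big_enum/=.
  have -> : \prod_(p : 'I_M * 'I_mY) Phi (n0, p.1, p.2) w (Y (n0, p.1, p.2) w) =
      expR ((k * mY)%:R * (th * centred_mean j w - kappa * th ^+ 2)).
    transitivity (\prod_(s in neighbours w) \prod_(h < mY)
        expR (th * (next_value j (Xt n s h w) w - next_mean j (Xs s n w) w) - kappa * th ^+ 2)).
      rewrite [RHS]big_mkcond/=.
      rewrite (eq_bigr (fun s => \prod_(h < mY) Phi (n0, s, h) w (Y (n0, s, h) w))).
        by rewrite pair_bigA.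
      by move=> s _; rewrite /Phi/=; case: ifP => // _; rewrite big1.
    under eq_bigr do rewrite -expR_sum.
    rewrite -expR_sum; congr expR.
    under eq_bigr do rewrite sumrB -mulr_sumr sumr_const card_ord.
    rewrite sumrB -mulr_sumr sumr_const card_neighbours mulrBr /centred_mean.
    congr (_ - _); first by rewrite mulrCA [_%:R * (_ * _)]mulrA divff ?mul1r// lt0r_neq0.
    by rewrite -mulrnA mulr_natl mulnC.
  by rewrite ler_expR ler_pM2l// lerD2r.
Qed.

End exponential_moment.

Lemma neighbours_outside_tail (X : nat -> Omega -> 'rV[R]_d) r :
  measurable_fun setT (X n) -> independent_copies P N X Xs ->
  (P [set w | ~~ neighbours_within r w] <= (expR (- (M%:R *
    Num.max ((M%:R - k%:R) / M%:R -
      fine (P [set w | (r < enorm (X n w - x))%R])) 0 ^+ 2 / 2)))%:E)%E.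
Proof.
move=> mX [indep law].
pose A s := [set w | r < enorm (Xs s n w - x)].
pose B := [set tp : N.+1.-tuple 'rV[R]_d | r < enorm (tnth tp (inord n) - x)].
have traj (Z : nat -> Omega -> 'rV[R]_d) :
    trajectory N Z @^-1` B = [set w | r < enorm (Z n w - x)].
  by apply/seteqP; split => w; rewrite /B /= tnth_mktuple inordK// ltnS ltnW.
have mlt dQ (Q : measurableType dQ) (z : Q -> 'rV[R]_d) : measurable_fun setT z ->
    measurable [set q | r < enorm (z q - x)].
  move=> mz; have := @measurable_fun_ltr _ _ R setT (fun=> r) (fun q => enorm (z q - x)).
  move=> /(_ _ _ measurableT [set true] I); rewrite setTI; apply => //.
  apply: (measurableT_comp (@measurable_enorm R d)).
  exact: measurable_funB_mx.
have mB : measurable B by apply: mlt; exact: measurable_tnth.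
have mA s : measurable (A s) by apply: mlt; apply: mXs; exact: ltnW.
have PX : P [set w | r < enorm (X n w - x)] =
    (fine (P [set w | (r < enorm (X n w - x))%R]))%:E.
  by rewrite fineK// fin_num_measure//; exact: mlt.
have mwithin : measurable_fun setT (neighbours_within r).
  exact: (@measurable_neighbours_within _ _ id).
have := @chernoff_count _ _ _ P 'I_M A k
  (fine (P [set w | (r < enorm (X n w - x))%R])).
rewrite card_ord; apply => //.
- by move=> s; rewrite /A -traj law// traj.
- move=> J; have := indep J (fun=> B) (fun=> mB).
  rewrite (eq_bigcapr (G := A)) => [->|s _]; last exact: traj.
  by apply: eq_bigr => s _; rewrite traj.
- have := mwithin measurableT [set false] I; rewrite setTI; congr (measurable _).
  by apply/seteqP; split => w /=; case: neighbours_within.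
- move=> w /=; rewrite negb_forall => /existsP[s0]; rewrite negb_imply => /andP[s0n].
  rewrite -ltNge => rs0.
  (* Each of the M - k points that are not neighbours is at least as far from [x] as the distant
     neighbour [s0], hence outside the ball as well. *)
  rewrite -(card_neighbours w) -[X in (X - _ <= _)%N](card_ord M).
  rewrite -(finset.setCK (neighbours w)) -cardsCs.
  apply/subset_leq_card/fintype.subsetP => s; rewrite !finset.inE => sn; rewrite mem_set//=.
  have [_ /(_ s0 s s0n sn)] := (nnP nN).1 [tuple Xs s n w | s < M] x.
  by rewrite !tnth_mktuple /A /=; exact: lt_le_trans.
Qed.

Let g_tilde_w (j : 'I_D) w := g_tilde k nn (fun s l => Xs s l w) (fun l s h => Xt l s h w) n
  (fun y => next_value j y w) x.

Lemma g_tilde_dist j r e w : neighbours_within r w ->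
  (forall z, enorm (z - x) <= r -> `|next_mean j z w - next_mean j x w| <= e) ->
  `|g_tilde_w j w - next_mean j x w| <= `|centred_mean j w| + e.
Proof.
move=> /forallP wr ge.
have kmY0 : (0 : R) < (k * mY)%:R by rewrite ltr0n muln_gt0 mY_gt0; case/andP: kM => ->.
have -> : g_tilde_w j w - next_mean j x w = centred_mean j w + (k * mY)%:R^-1 *
    \sum_(s in neighbours w) \sum_(h < mY) (next_mean j (Xs s n w) w - next_mean j x w).
  rewrite /centred_mean -mulrDr -big_split/=.
  under [in RHS]eq_bigr do rewrite -big_split/=.
  rewrite [in RHS](eq_bigr (fun s => \sum_(h < mY) next_value j (Xt n s h w) w -
    next_mean j x w *+ mY)).
    rewrite sumrB sumr_const card_neighbours mulrBr -mulrnA [(mY * k)%N]mulnC.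
    by rewrite -[X in _ - _ * X]mulr_natl mulKf// lt0r_neq0.
  move=> s _; have -> : next_mean j x w *+ mY = \sum_(h < mY) next_mean j x w.
    by rewrite sumr_const card_ord.
  by rewrite -sumrB; apply: eq_bigr => h _; rewrite addrA subrK.
apply: (le_trans (ler_normD _ _)); rewrite lerD2l normrM.
rewrite [X in X * _]ger0_norm ?invr_ge0 ?ler0n// ler_pdivrMl//.
apply: (le_trans (ler_norm_sum _ _ _)).
apply: (@le_trans _ _ (\sum_(s in neighbours w) \sum_(h < mY) e)).
  apply: ler_sum => s sn; apply: (le_trans (ler_norm_sum _ _ _)).
  by apply: ler_sum => h _; apply: ge; have /implyP := wr s; exact.
under eq_bigr do rewrite sumr_const card_ord.
by rewrite sumr_const card_neighbours -mulrnA mulr_natl mulnC.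
Qed.

Lemma measurable_V_hat_error i : measurable_fun setT (fun w =>
  `|V_hat N k T f c trunc nn (fun s l => Xs s l w) (fun l s h => Xt l s h w) n i x -
    V_tilde N k T f c rho trunc nn (fun s l => Xs s l w) (fun l s h => Xt l s h w) n i x|).
Proof.
apply: measurableT_comp => //; apply: measurable_funB.
  apply: (@measurable_V_hat R d D M mY N k T f c trunc nn T_gt0 mf mc nnP _ _ Xs Xt) => //.
  + by move=> s l /andP[_]; move=> /ltnW; exact: mXs.
  + by move=> l s h /andP[_]; exact: mXt.
apply: (@measurable_best_switch R d D N T f c T_gt0 mf mc _ _ n i
  (fun j w => next_mean j x w) (fun=> x)) => // j.
apply: (@measurable_next_mean _ _ id) => //.
by move=> l s h /andP[_]; exact: mXt.
Qed.

Lemma V_hat_deviation (X : nat -> Omega -> 'rV[R]_d) r kappa delta i :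
  measurable_fun setT (X n) -> independent_copies P N X Xs ->
  0 < kappa -> 0 < delta -> r <= 1 ->
  {ae P, forall w, [/\ forall j, `|next_mean j x w| <= 2 * trunc n * (enorm x + 1),
    forall j z, enorm (z - x) <= r ->
      `|next_mean j z w - next_mean j x w| <= delta / 2 &
    forall j z th, enorm (z - x) <= 1 ->
      (\int[leb]_y (expR (th * (next_value j y w - next_mean j z w)) * step_density n z y)%:E
        <= (expR (kappa * th ^+ 2))%:E)%E]} ->
  (P [set w | delta <= `|V_hat N k T f c trunc nn (fun s l => Xs s l w)
        (fun l s h => Xt l s h w) n i x -
      V_tilde N k T f c rho trunc nn (fun s l => Xs s l w)
        (fun l s h => Xt l s h w) n i x|]%R
   <= (2 * D%:R * expR (- ((k * mY)%:R * (delta ^+ 2 / (16 * kappa)))) +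
       expR (- (M%:R *
         Num.max ((M%:R - k%:R) / M%:R -
      fine (P [set w | (r < enorm (X n w - x))%R])) 0 ^+ 2 / 2)))%:E)%E.
Proof.
move=> mX copies kappa0 delta0 r1 regular.
pose V w := V_hat N k T f c trunc nn (fun s l => Xs s l w) (fun l s h => Xt l s h w) n i x.
pose W w := V_tilde N k T f c rho trunc nn (fun s l => Xs s l w) (fun l s h => Xt l s h w) n i x.
(* The regularity holds almost surely only; the error event is covered up to the null set [N0]. *)
have [N0 [mN0 PN0 N0sub]] := regular.
(* The absolute value delta / (4 kappa) maximises th * delta/2 - kappa th^2, with maximum delta^2 /
   (16 kappa). The boolean selects the tail, so the union over modes and signs has 2D terms. *)
pose th (b : bool) : R := (-1) ^+ b * (delta / (4 * kappa)).
pose tail (jb : 'I_D * bool) := [set w | neighbours_within r w /\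
  delta / (4 * kappa) * (delta / 2) <= th jb.2 * centred_mean jb.1 w].
have thE b : th b ^+ 2 = (delta / (4 * kappa)) ^+ 2.
  by rewrite /th exprMn -exprM mulnC exprM sqrrN expr1n expr1n mul1r.
have tailP jb : (P (tail jb) <= (expR (- ((k * mY)%:R * (delta ^+ 2 / (16 * kappa)))))%:E)%E.
  have sub_th : {ae P, forall w z, enorm (z - x) <= 1 ->
      (\int[leb]_y (expR (th jb.2 * (next_value jb.1 y w - next_mean jb.1 z w)) * step_density n z y)%:E
        <= (expR (kappa * th jb.2 ^+ 2))%:E)%E}.
    by apply: filterS regular => w [_ _ + z]; exact.
  apply: (le_trans (centred_mean_tail r1 sub_th _)).
  rewrite lee_fin ler_expR lerN2 ler_wpM2l// thE.
  by rewrite le_eqVlt; apply/orP; left; apply/eqP; field; lra.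
have [mtails tailsP] := union_bound (fun jb => measurable_tail_event _ _ _ _) tailP.
rewrite -/tail in mtails tailsP.
have mwithin : measurable [set w | ~~ neighbours_within r w].
  have := @measurable_neighbours_within _ _ id mXs r measurableT [set false] I.
  by rewrite setTI; congr (measurable _); apply/seteqP; split => w /=; case: neighbours_within.
have mVW : measurable_fun setT (fun w => `|V w - W w|).
  exact: measurable_V_hat_error.
have mE : measurable [set w | delta <= `|V w - W w|].
  by rewrite -[X in measurable X]setTI; exact: measurable_fun_le.
have Esub : [set w | delta <= `|V w - W w|] `<=`
    N0 `|` ([set w | ~~ neighbours_within r w] `|` \bigcup_(jb in [set: 'I_D * bool]) tail jb).
  move=> w /= dVW; have [N0w|nN0w] := pselect (N0 w); [by left|right].
  have [trw gw _] : [/\ forall j, `|next_mean j x w| <= 2 * trunc n * (enorm x + 1),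
      forall j z, enorm (z - x) <= r ->
        `|next_mean j z w - next_mean j x w| <= delta / 2 &
      forall j z th, enorm (z - x) <= 1 ->
        (\int[leb]_y (expR (th * (next_value j y w - next_mean j z w)) * step_density n z y)%:E
          <= (expR (kappa * th ^+ 2))%:E)%E].
    by apply: contrapT => nQ; apply: nN0w; exact: N0sub.
  have [wr|] := boolP (neighbours_within r w); [right|by left].
  move: dVW; rewrite /V /W V_hatE// => /best_switch_dist[j dj].
  have {}dj : delta / 2 <= `|centred_mean j w|.
    have := le_trans dj (trunc_dist (g_tilde_w j w) (trw j)).
    move=> /le_trans /(_ (g_tilde_dist wr (gw j))); lra.
  exists (j, centred_mean j w < 0) => //; split => //=.
  have -> : th (centred_mean j w < 0) * centred_mean j w =
      delta / (4 * kappa) * `|centred_mean j w|.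
    by rewrite /th mulrAC mulrC -normrEsign.
  by rewrite ler_wpM2l// divr_ge0 ?mulr_ge0// ltW.
apply: (@le_trans _ _ (P (N0 `|`
    ([set w | ~~ neighbours_within r w] `|` \bigcup_(jb in [set: 'I_D * bool]) tail jb)))).
  apply: le_measure => //; rewrite inE//.
  by apply: measurableU => //; exact: measurableU.
apply: (le_trans (measureU2 _ _ _)) => //; first exact: measurableU.
rewrite [X in (X + _)%E]PN0 add0e.
apply: (le_trans (measureU2 _ _ _)) => //.
rewrite [X in (_ <= X%:E)%E]addrC EFinD; apply: leeD; first exact: neighbours_outside_tail.
by apply: (le_trans tailsP); rewrite card_prod card_ord card_bool natrM [_ * 2]mulrC.
Qed.

End nearest_neighbour_regression.

(** * Growth, Lipschitz and exponential-moment bounds for the exact mean *)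

Section regularity.
Context {R : realType} (d : nat).
Local Notation leb := (lebesgue_rV d : {sigma_finite_measure set 'rV[R]_d -> \bar R}).
Variables (L l1 l2 c1 c2 C0 : R).
Hypotheses (L0 : 0 < L) (l10 : 0 < l1) (l20 : 0 < l2) (c10 : 0 < c1) (c20 : 0 < c2).
Hypothesis c1E : forall z : 'rV[R]_d,
  (\int[leb]_y (expR (- (l1 / 2 * enorm (z - y) ^+ 2)))%:E = c1%:E)%E.
Hypothesis c2E : forall z : 'rV[R]_d,
  (\int[leb]_y (expR (- (l2 / 4 * enorm (z - y) ^+ 2)))%:E = c2%:E)%E.
Hypothesis C0E : C0 = L * expR (4 * (l1 / 2))^-1 * l1^-1 * c1.
Variables (V : 'rV[R]_d -> R) (q : 'rV[R]_d -> 'rV[R]_d -> R).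
Hypothesis mV : measurable_fun setT V.
Hypothesis VL : forall y, `|V y| <= L * (enorm y + 1).
Hypothesis mq : forall z, measurable_fun setT (q z).
Hypothesis q0 : forall z y, 0 <= q z y.
Hypothesis q1 : forall z, (\int[leb]_y (q z y)%:E = 1)%E.
Hypothesis ql1 : forall z y, `|q z y| <= l1^-1 * expR (- (l1 * enorm (z - y) ^+ 2)).
Hypothesis ql2 : forall y z, differentiable (fun z => q z y) z /\
  enorm (gradient (fun z => q z y) z) <= l2^-1 * expR (- (l2 * enorm (z - y) ^+ 2)).

Let g z := Rintegral leb setT (fun y => V y * q z y).

Let growth z : leb.-integrable setT (EFin \o (fun y => V y * q z y)) /\
  `|g z| <= L * (enorm z + 1) * expR (4 * (l1 / 2))^-1 * l1^-1 * c1.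
Proof.
apply: growth_gauss_integral (c1E z) mV (mq z) VL _; rewrite ?(ltW L0) ?invr_ge0 ?(ltW l10)//.
  by rewrite divr_gt0.
by move=> y; have := ql1 z y; rewrite (_ : 2 * (l1 / 2) = l1)//; field.
Qed.

Lemma mean_growth z : `|g z| <= C0 * (enorm z + 1).
Proof.
by apply: (le_trans (growth z).2); rewrite C0E le_eqVlt; apply/orP; left; apply/eqP; ring.
Qed.

(** The rate l2 of the gradient is halved when the centre is moved from the segment to [x], and
    halved again to absorb the growth of [V]; hence l2 / 4. *)
Lemma mean_lipschitz x z : enorm (z - x) <= 1 ->
  `|g z - g x| <= L * (enorm x + 1) * expR (4 * (l2 / 4))^-1 * (l2^-1 * expR l2) * c2
    * enorm (z - x).
Proof.
move=> zx1.
have -> : g z - g x = Rintegral leb setT (fun y => V y * (q z y - q x y)).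
  rewrite -RintegralB//; last 2 first.
  - by have [] := growth z.
  - by have [] := growth x.
  by apply: eq_Rintegral => y _; rewrite mulrBr.
have [] := @growth_gauss_integral R d L (l2 / 4) c2 (enorm (z - x) * (l2^-1 * expR l2))
  V (fun y => q z y - q x y) x (ltW L0) _ _ (c2E x) mV _ VL _.
- by rewrite divr_gt0.
- by rewrite !mulr_ge0 ?enorm_ge0 ?expR_ge0// invr_ge0 ltW.
- exact: measurable_funB.
- move=> y; rewrite (_ : 2 * (l2 / 4) = l2 / 2); last by field.
  by rewrite -[leRHS]mulrA;
  exact: (@gaussian_mean_value R d (fun u => q u y) x y z l2 l20 zx1 (ql2 y)).
move=> _ h; apply: (le_trans h); rewrite le_eqVlt; apply/orP; left; apply/eqP; ring.
Qed.

(** Uniformity in [z] comes from L (|z| + 1) + |g z| <= (L + C0)(|z| + 1) <= (L + C0)(|x| + 2). *)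
Lemma mean_mgf x z th : enorm (z - x) <= 1 ->
  let a := l1 / (4 * L ^+ 2) in
  let K := l1^-1 * expR (2 * a * ((L + C0) * (enorm x + 2)) ^+ 2) * c1 in
  ((\int[leb]_y (expR (th * (V y - g z)) * q z y)%:E <=
    (expR ((1 / 2 + 2 * K) / a * th ^+ 2))%:E)%E : Prop).
Proof.
move=> zx1 a K.
have C00 : 0 <= C0 by rewrite C0E !mulr_ge0 ?expR_ge0 ?invr_ge0// ltW.
have zx : enorm z <= enorm x + 1.
  have := enormD x (z - x); rewrite addrC subrK; lra.
have := @subgaussian_mgf R d L l1 c1 ((L + C0) * (enorm x + 2)) V (q z) z (g z) a K th.
move=> /(_ L0 l10); apply => //.
- exact: ltW.
- by rewrite mulr_ge0// addr_ge0 ?enorm_ge0// ltW.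
- by move=> y; exact: le_trans (ler_norm _) (ql1 z y).
- apply: le_trans (lerD (lexx _) (mean_growth z)) _.
  by rewrite -mulrDl ler_wpM2l ?addr_ge0 ?(ltW L0)//; lra.
Qed.

End regularity.

Theorem theorem5p4 (R : realType) (d : nat) (L normx lambda1 lambda2 : R)
    (d_gt0 : (0 < d)%N) (L_gt0 : 0 < L)
    (lambda1_gt0 : 0 < lambda1) (lambda2_gt0 : 0 < lambda2) :
  exists C0 C2 sigma : R, [/\ 0 < C0, 0 < C2, 0 < sigma &
  forall (D M N mY k : nat),
    (0 < D)%N -> (0 < M)%N -> (0 < N)%N -> (0 < mY)%N -> (0 < k <= M)%N ->
  forall (T : R), 0 < T ->
  let dt := T / N%:R in
  let t := grid T N in
  (* payoffs, switching costs, one-step transition densities *)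
  forall (f : 'I_D -> R -> 'rV[R]_d -> R)
    (c : 'I_D -> 'I_D -> R -> 'rV[R]_d -> R)
    (rho : 'rV[R]_d -> R -> 'rV[R]_d -> R -> R),
    (forall j s, 0 <= s <= T -> measurable_fun setT (f j s)) ->
    (forall i j s, 0 <= s <= T -> measurable_fun setT (c i j s)) ->
    switching_costs T c ->
    transition_density N T rho ->
  (* the Markov process and the simulated data *)
  forall (dO : measure_display) (Omega : measurableType dO)
    (P : probability Omega R) (mu0 : probability 'rV[R]_d R)
    (X : nat -> Omega -> 'rV[R]_d)
    (Xs : 'I_M -> nat -> Omega -> 'rV[R]_d)
    (Xt : nat -> 'I_M -> 'I_mY -> Omega -> 'rV[R]_d),
    (forall l, (l <= N)%N -> measurable_fun setT (X l)) ->
    (forall s l, (l <= N)%N -> measurable_fun setT (Xs s l)) ->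
    (forall l s h, (l < N)%N -> measurable_fun setT (Xt l s h)) ->
    sub_gaussian mu0 ->
    markov_process P N T mu0 rho X ->
    independent_copies P N X Xs ->
    one_step_samples P N T rho Xs Xt ->
  (* nearest-neighbour rules and truncation constants, time by time *)
  forall (nn : nat -> M.-tuple 'rV[R]_d -> 'rV[R]_d -> {set 'I_M})
    (trunc : nat -> R) (n : nat),
    (forall l, (l < N)%N -> nearest_neighbour_rule k (nn l)) ->
    (n < N)%N ->
    trunc n = C0 ->
  let Vhat l i z w := V_hat N k T f c trunc nn
    (fun s l' => Xs s l' w) (fun l' s h => Xt l' s h w) l i z in
  let Vtilde l i z w := V_tilde N k T f c rho trunc nn
    (fun s l' => Xs s l' w) (fun l' s h => Xt l' s h w) l i z in
    (forall l x y, (l < N)%N ->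
      `|rho x (t l) y (t l + dt)|
        <= lambda1^-1 * expR (- (lambda1 * enorm (x - y) ^+ 2))) ->
    (forall l x y, (l < N)%N ->
      differentiable (fun z => rho z (t l) y (t l + dt)) x /\
      enorm (gradient (fun z => rho z (t l) y (t l + dt)) x)
        <= lambda2^-1 * expR (- (lambda2 * enorm (x - y) ^+ 2))) ->
    {ae P, forall w, forall i z, `|Vhat n.+1 i z w| <= L * (enorm z + 1)} ->
  forall x : 'rV[R]_d, enorm x = normx ->
  let pc r := fine (P [set w | r < enorm (X n w - x)]) in
  let E r := expR (- (M%:R *
    Num.max ((M%:R - k%:R) / M%:R - pc r) 0 ^+ 2 / 2)) in
  let B delta := if delta / C2 <= 1 then E (delta / (4 * C2))
    else E (Num.sqrt (delta / (4 * C2))) in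
  forall (delta : R) (i : 'I_D), 0 < delta ->
    (P [set w | delta <= `|Vhat n i x w - Vtilde n i x w|]%R <=
      (2 * D%:R * expR (- (k%:R * mY%:R * delta ^+ 2 / (18 * sigma ^+ 2)))
       + 2 * D%:R * B delta)%:E)%E].
Proof.
have [c1 c10 c1E] := @integral_gauss_rV R (lambda1 / 2) d (divr_gt0 lambda1_gt0 (ltr0Sn _ 1)).
have [c2 c20 c2E] := @integral_gauss_rV R (lambda2 / 4) d (divr_gt0 lambda2_gt0 (ltr0Sn _ 3)).
(* [normx] is quantified before [x] and may be negative; the absolute value keeps the constants
   positive in every case. *)
pose nx := `|normx|.
have nx0 : 0 <= nx by exact: normr_ge0.
pose C0 := L * expR (4 * (lambda1 / 2))^-1 * lambda1^-1 * c1.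
have C0_gt0 : 0 < C0 by rewrite !mulr_gt0 ?expR_gt0 ?invr_gt0.
pose Lip := L * (nx + 1) * expR (4 * (lambda2 / 4))^-1 * (lambda2^-1 * expR lambda2) * c2.
have Lip_gt0 : 0 < Lip by rewrite !mulr_gt0 ?expR_gt0 ?invr_gt0//; lra.
pose a := lambda1 / (4 * L ^+ 2).
have a_gt0 : 0 < a by rewrite divr_gt0// mulr_gt0// exprn_gt0.
pose K := lambda1^-1 * expR (2 * a * ((L + C0) * (nx + 2)) ^+ 2) * c1.
have K_gt0 : 0 < K by rewrite !mulr_gt0 ?expR_gt0 ?invr_gt0.
pose kappa := (1 / 2 + 2 * K) / a.
have kappa_gt0 : 0 < kappa by rewrite divr_gt0//; lra.
(* The first summand is the truncation level 2 C0 (|x| + 1) plus the bound C0 (|x| + 1) on the exact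
   mean; the second makes the bias over a radius delta / (4 C2) at most delta / 4. *)
pose C2 := 3 * C0 * (nx + 1) + Lip.
have C2_gt0 : 0 < C2 by rewrite addr_gt0// mulr_gt0//; lra.
exists C0, C2, (Num.sqrt kappa); split => //; first by rewrite sqrtr_gt0.
move=> D M N mY k D0 M0 N0 mY0 kM T T0 dt t f c rho mf mc _ rhoP dO Omega P mu0 X Xs Xt.
move=> mX mXs mXt _ _ copies samples nn trunc n nnP nN truncE Vhat Vtilde.
move=> rho1 rho2 Vgrowth x xE pc E B delta i delta0.
have nxE : nx = enorm x by rewrite /nx -xE ger0_norm ?enorm_ge0.
pose V j y w := next_value N k T f c Xs Xt nn trunc n j y w.
pose g j z w := next_mean N k T f c rho Xs Xt nn trunc n j z w.
have mV j w : measurable_fun setT (fun y => V j y w).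
  exact: (@measurable_next_value _ _ _ _ _ _ _ _ T0 _ _ mf mc _ _ Xs Xt _ _ _ nnP _ _ (fun=> w)).
have [_ q0 q1] := rhoP _ nN.
have mq z := measurable_step_density rhoP z nN.
have regular : {ae P, forall w, [/\ forall j z, `|g j z w| <= C0 * (enorm z + 1),
    forall j z, enorm (z - x) <= 1 -> `|g j z w - g j x w| <= Lip * enorm (z - x) &
    forall j z th, enorm (z - x) <= 1 ->
      (\int[lebesgue_rV d]_y (expR (th * (V j y w - g j z w)) * step_density N T rho n z y)%:E
        <= (expR (kappa * th ^+ 2))%:E)%E]}.
  apply: filterS Vgrowth => w Vw; split => j z.
  - exact: (mean_growth L_gt0 lambda1_gt0 c1E erefl (mV j w) (Vw j) mq (fun z y => rho1 n z y nN)).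
  - move=> zx; have := mean_lipschitz L_gt0 lambda1_gt0 lambda2_gt0 c1E c2E (mV j w) (Vw j)
      mq (fun z y => rho1 n z y nN) (fun y z => rho2 n z y nN) zx.
    by rewrite -nxE.
  - move=> th zx; have := mean_mgf L_gt0 lambda1_gt0 c10 c1E erefl (mV j w) (Vw j)
      mq q0 q1 (fun z y => rho1 n z y nN) th zx.
    by rewrite -nxE.
have mErr : measurable [set w | delta <= `|Vhat n i x w - Vtilde n i x w|].
  rewrite -[X in measurable X]setTI; apply: measurable_fun_le => //.
  exact: measurable_V_hat_error.
have E0 r : 0 <= E r by exact: expR_ge0.
have [dC2|dC2] := leP (delta / C2) 1; last first.
  (* beyond C2 the truncation leaves no room for an error of size delta *)
  have /negligibleP -> // : P.-negligible [set w | delta <= `|Vhat n i x w - Vtilde n i x w|].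
    apply: negligibleS regular => w /= dV [gw _ _].
    move: dV; rewrite /Vhat /Vtilde V_hatE// => /best_switch_dist[j].
    have /(trunc_le (g_tilde k nn (fun s l => Xs s l w) (fun l s h => Xt l s h w) n
      (fun y => V j y w) x)) h1 : 0 <= 2 * trunc n * (enorm x + 1).
      by rewrite truncE mulr_ge0 ?addr_ge0 ?enorm_ge0// mulr_ge0// ltW.
    have h2 := gw j x.
    move=> /le_trans /(_ (ler_normB _ _)); apply/negP; rewrite -ltNge.
    apply: (le_lt_trans (lerD h1 h2)).
    rewrite truncE -nxE; move: dC2; rewrite ltr_pdivlMr// mul1r; apply: le_lt_trans.
    rewrite /C2; lra.
  rewrite lee_fin addr_ge0// !mulr_ge0 ?expR_ge0//.
  by rewrite /B; case: ifP.
pose r := delta / (4 * C2).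
have r0 : 0 < r by rewrite divr_gt0// mulr_gt0.
have rE : r = delta / C2 / 4 by rewrite /r; field; lra.
have r1 : r <= 1 by lra.
apply: (le_trans (V_hat_deviation (x := x) (r := r) mY0 kM T0 mf mc rhoP mXs mXt samples nnP nN i
  (mX n (ltnW nN)) copies kappa_gt0 delta0 r1 _)).
  apply: filterS regular => w [gw1 gw2 gw3]; split => //.
  - move=> j; apply: (le_trans (gw1 j x)).
    have : 0 <= C0 * (enorm x + 1) by rewrite mulr_ge0 ?addr_ge0 ?enorm_ge0// ltW.
    rewrite truncE -mulrA; lra.
  - move=> j z zr; apply: (le_trans (gw2 j z (le_trans zr r1))).
    apply: (@le_trans _ _ (C2 * r)).
      apply: ler_pM => //; [exact: ltW|exact: enorm_ge0|].
      have : 0 <= C0 * (nx + 1) by rewrite mulr_ge0 ?addr_ge0// ltW.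
      by rewrite /C2; lra.
    rewrite rE (_ : C2 * (delta / C2 / 4) = delta / 4); last by field; lra.
    lra.
(* There is slack in both terms: 16 [kappa] against 18 sigma^2 = 18 [kappa] in the first, and a
   single [E r] against 2D copies in the second. *)
rewrite lee_fin /B dC2 -/r; apply: lerD.
  apply: ler_wpM2l; first by rewrite mulr_ge0.
  rewrite ler_expR lerN2 natrM sqr_sqrtr ?(ltW kappa_gt0)//.
  rewrite -[leLHS]mulrA ler_wpM2l ?mulr_ge0//.
  have [h16 h18] : 0 < 16 * kappa /\ 0 < 18 * kappa by split; exact: mulr_gt0.
  by rewrite ler_wpM2l ?sqr_ge0// lef_pV2 ?posrE// ler_pM2r// ler_nat.
have D1 : 1 <= D%:R :> R by rewrite ler1n.
rewrite -/(pc r) -/(E r) ler_peMl//; lra.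
Qed.
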